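(* Let $k\geq 3$ be a constant. There is a deterministic algorithm that, given an $\mathsf{NC}^0_k$ circuit $C\colon\{0,1\}^n\to\{0,1\}^m$ with $m\geq 3n^{k-2}$, outputs an element $y\in\{0,1\}^m$ with $y\notin\mathrm{Range}(C)$, in time $2^{O(n^{k-1}/m)}\cdot\mathrm{poly}(n)$.
   Context: An $\mathsf{NC}^0_k$ circuit is a multi-output Boolean function $C\colon\{0,1\}^n\to\{0,1\}^m$ in which each output bit depends on at most $k$ input bits, described by listing, for each output, the input bits it reads and its truth table.
   Formalization: The factor poly(n) is proved as poly(n+m): m has no upper bound in terms of n, and writing the m output bits already takes m steps; for m polynomial in n the two agree. The case n = m = 0, where no such y exists, is excluded. *)

(* Defs.v *)
From mathcomp Require Import all_boot.

Set Implicit Arguments.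
Unset Strict Implicit.
Unset Printing Implicit Defensive.

(* NC^0_k circuits.  In a gate, entry [j] of the truth table is the output on
   the assignment to [wires] spelled by the binary digits of [j], the first
   wire being the least significant digit. *)

Record gate (k n : nat) := Gate {
  arity : 'I_k.+1;
  wires : arity.-tuple 'I_n;
  table : (2 ^ arity).-tuple bool
}.

Definition bits_val (s : seq bool) : nat :=
  foldr (fun (b : bool) v => b + v.*2) 0 s.

Definition gate_eval k n (g : gate k n) (x : n.-tuple bool) : bool :=
  nth false (table g) (bits_val [seq tnth x i | i <- wires g]).

Definition circuit (k n m : nat) := m.-tuple (gate k n).

Definition circuit_eval k n m (C : circuit k n m) (x : n.-tuple bool) :
    m.-tuple bool :=
  [tuple gate_eval (tnth C i) x | i < m].

(* Machine model: N. D. Jones' WHILE language ("Computability and Complexity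
   from a Programming Perspective", MIT Press, 1997), whose data are binary
   trees.  Time is the number of elementary operations executed.  Since trees
   can be shared in memory, every operation is a constant number of pointer
   manipulations, and WHILE and Turing machines simulate each other with
   polynomial overhead. *)

Inductive tree := Nil | Cons of tree & tree.

Definition tree_hd (t : tree) := if t is Cons a _ then a else Nil.
Definition tree_tl (t : tree) := if t is Cons _ b then b else Nil.

Inductive expr :=
  | Var of nat
  | ENil
  | ECons of expr & expr
  | EHd of expr
  | ETl of expr.

Inductive cmd :=
  | Assign of nat & expr
  | Seq of cmd & cmd
  | If of expr & cmd & cmd
  | While of expr & cmd.

Definition store := nat -> tree.

Definition update (s : store) (v : nat) (t : tree) : store :=
  fun w => if w == v then t else s w.

Fixpoint eval (s : store) (e : expr) : tree :=
  match e with
  | Var v => s v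
  | ENil => Nil
  | ECons e1 e2 => Cons (eval s e1) (eval s e2)
  | EHd e1 => tree_hd (eval s e1)
  | ETl e1 => tree_tl (eval s e1)
  end.

Fixpoint cost (e : expr) : nat :=
  match e with
  | Var _ | ENil => 1
  | ECons e1 e2 => (cost e1 + cost e2).+1
  | EHd e1 | ETl e1 => (cost e1).+1
  end.

(* [exec p s s' t]: from store [s], [p] halts in store [s'] after exactly [t]
   steps.  Tests treat [Nil] as false and every other tree as true. *)
Inductive exec : cmd -> store -> store -> nat -> Prop :=
  | ExecAssign v e s :
      exec (Assign v e) s (update s v (eval s e)) (cost e).+1
  | ExecSeq p q s1 s2 s3 t1 t2 :
      exec p s1 s2 t1 -> exec q s2 s3 t2 -> exec (Seq p q) s1 s3 (t1 + t2)
  | ExecIfTrue e p q s s' t :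
      eval s e <> Nil -> exec p s s' t ->
      exec (If e p q) s s' ((cost e).+1 + t)
  | ExecIfFalse e p q s s' t :
      eval s e = Nil -> exec q s s' t ->
      exec (If e p q) s s' ((cost e).+1 + t)
  | ExecWhileTrue e p s1 s2 s3 t1 t2 :
      eval s1 e <> Nil -> exec p s1 s2 t1 -> exec (While e p) s2 s3 t2 ->
      exec (While e p) s1 s3 ((cost e).+1 + t1 + t2)
  | ExecWhileFalse e p s :
      eval s e = Nil -> exec (While e p) s s (cost e).+1.

Lemma exec_deterministic p s s1 s2 t1 t2 :
  exec p s s1 t1 -> exec p s s2 t2 -> s1 = s2 /\ t1 = t2.
Proof.
move=> H; elim: H s2 t2 => {p s s1 t1}.
- by move=> v e s s2 t2 H; inversion H.
- move=> p q s1 s2 s3 t1 t2 _ IHp _ IHq s' t' H; inversion H; subst.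
  have [? ?] := IHp _ _ H2; subst.
  by have [-> ->] := IHq _ _ H6.
- move=> e p q s s' t ne _ IH s2 t2 H; inversion H; subst => //.
  by have [-> ->] := IH _ _ H7.
- move=> e p q s s' t eq _ IH s2 t2 H; inversion H; subst => //.
  by have [-> ->] := IH _ _ H7.
- move=> e p s1 s2 s3 t1 t2 ne _ IHp _ IHw s' t' H; inversion H; subst => //.
  have [? ?] := IHp _ _ H3; subst.
  by have [-> ->] := IHw _ _ H7.
- by move=> e p s eq s2 t2 H; inversion H; subst.
Qed.

(* Variable 0 holds the input at the start and the output at the end; all other
   variables are initially [Nil]. *)
Definition halts_with (p : cmd) (input output : tree) (t : nat) : Prop :=
  exists2 s, exec p (update (fun=> Nil) 0 input) s t & s 0 = output.

(* Numbers are encoded in unary: [n] and the wire indices, which are below [n],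
   then have size polynomial in [n].  The number of outputs is the length of
   the list of gates. *)

Definition enc_nat (i : nat) : tree := iter i (Cons Nil) Nil.
Definition enc_bool (b : bool) : tree := if b then Cons Nil Nil else Nil.
Definition enc_seq T (enc : T -> tree) (s : seq T) : tree :=
  foldr (fun a r => Cons (enc a) r) Nil s.

Definition enc_gate k n (g : gate k n) : tree :=
  Cons (enc_seq (fun i : 'I_n => enc_nat i) (wires g))
       (enc_seq enc_bool (table g)).

Definition enc_circuit k n m (C : circuit k n m) : tree :=
  Cons (enc_nat n) (enc_seq (@enc_gate k n) C).

Definition enc_bits m (y : m.-tuple bool) : tree := enc_seq enc_bool y.

(* A bound 2^{O(n^{k-1}/m)} poly(n), with one constant [c] for the exponent, the
   polynomial and the leading factor.
   - Replacing the real exponent by its integer part changes the power of 2 by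
     a factor at most 2.
   - The polynomial is in [n + m], which for [m] polynomial in [n] is a
     polynomial in [n]; for larger [m] no bound by a polynomial in [n] alone is
     possible, since the output consists of [m] bits. *)
Definition time_bound (c k n m : nat) : nat :=
  c * 2 ^ ((c * n ^ (k - 1)) %/ m) * (n + m) ^ c.

(* Main.v *)
(* Branch on the values of a set S of inputs such that at least 3n gates read
   all but two of their inputs in S.  In each of the 2^|S| branches such a gate
   depends on two unknowns only, and the inputs compatible with the branch and
   with the outputs fixed so far lie in the solution space of a system of
   equations x_i = x_j + b.  For at least one of the two outputs of a gate the
   requirement that it take this value makes the system inconsistent or adds an
   independent equation.  Hence the better output multiplies the total size of
   the solution spaces by at most 3/4, and since (3/4)^(3n) 2^n < 1 no branch
   survives.  The set S is chosen greedily, k - 2 inputs at a time: by the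
   pigeonhole principle over the sets of k - 2 inputs, every choice adds at
   least m / O(n^(k-2)) gates, hence |S| = O(1 + n^(k-1) / m). *)

Require Import Defs.
From mathcomp Require Import all_boot.
From mathcomp Require Import zify.
(* mathcomp also has abbreviations named [Nil] and [Cons]. *)
Import Defs.

Set Implicit Arguments.
Unset Strict Implicit.
Unset Printing Implicit Defensive.

(** Once S is fixed, the condition that a gate outputs y need not be affine in its two unknowns.
    Only an affine consequence is kept: an output attained at no more than two of the four points
    confines the unknowns to a line of F_2^2, and every such line is x = c, y = c or x + y = c,
    again an equation of the allowed shape. Hence a branch never splits after S is exhausted, and at
    most 2^|S| systems are ever alive. Different branches may prefer different outputs, so the
    choice is made on the total weight: within each branch the weights for the two outputs add up to
    at most 1 + 1/2 times the old one, hence so do the totals, and the smaller total is at most 3/4.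
    Weights go up to 2^(n+1), too large for unary numbers; totals are therefore compared digit by
    digit on lists of exponents. The WHILE program is not written by hand. It comes from closure
    properties of a class of functions whose time is polynomial in the size of the argument and in
    an extra parameter [mu], which in the end is 2^|S|. *)

(** * Program combinators and their costs *)

Fixpoint tsize (t : tree) : nat :=
  if t is Cons a b then (tsize a + tsize b).+1 else 1.

(* Variable 0 carries the argument and the result; variable 1 is a stack that
   every program leaves as it found it, so that programs can be nested freely. *)
Definition runs (p : cmd) (x y : tree) (T : nat) : Prop :=
  forall s, s 0 = x ->
    exists s' t, [/\ exec p s s' t, s' 0 = y, s' 1 = s 1 & t <= T].

Lemma runsW p x y T T' : T <= T' -> runs p x y T -> runs p x y T'.
Proof.
move=> le r s /r [s' [t [h1 h2 h3 h4]]].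
by exists s', t; split => //; apply: leq_trans le.
Qed.

Local Notation set_var s v e := (update s v (eval s e)).

Lemma exec_assign_seq v e p s s' t :
  exec p (set_var s v e) s' t ->
  exec (Seq (Assign v e) p) s s' ((cost e).+1 + t).
Proof. by apply: ExecSeq; exact: ExecAssign. Qed.

Lemma runs_expr e (f : tree -> tree) x :
  (forall s, s 0 = x -> eval s e = f x) -> runs (Assign 0 e) x (f x) (cost e).+1.
Proof. by move=> h s /h <-; do 2 eexists; split; first exact: ExecAssign. Qed.

Lemma runs_seq p q x y z T U :
  runs p x y T -> runs q y z U -> runs (Seq p q) x z (T + U).
Proof.
move=> rp rq s /rp [s1 [t1 [e1 h1 g1 l1]]].
have [s2 [t2 [e2 h2 g2 l2]]] := rq _ h1.
exists s2, (t1 + t2); split; rewrite ?g2 ?leq_add //.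
by apply: ExecSeq e1 e2.
Qed.

Definition push e := Assign 1 (ECons e (Var 1)).
Definition pop := Assign 1 (ETl (Var 1)).
Definition top := EHd (Var 1).

(** The argument waits on the stack while [p] runs. Variable 2 serves to swap it with the result of
    [p]; it is never live while [p] or [q] runs, since both may overwrite it. *)
Definition pair_cmd p q :=
  Seq (push (Var 0)) (Seq p (Seq (Assign 2 top) (Seq pop (Seq (push (Var 0))
    (Seq (Assign 0 (Var 2)) (Seq q
    (Seq (Assign 0 (ECons top (Var 0))) pop))))))).

Lemma runs_pair p q x y z T U : runs p x y T -> runs q x z U ->
  runs (pair_cmd p q) x (Cons y z) (T + U + 30).
Proof.
move=> rp rq s hx.
set s0 := set_var s 1 (ECons (Var 0) (Var 1)).
have [s1 [t1 [e1 h1 g1 l1]]] := rp s0 hx.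
set s2 := set_var s1 2 top; set s3 := set_var s2 1 (ETl (Var 1)).
set s4 := set_var s3 1 (ECons (Var 0) (Var 1)).
set s5 := set_var s4 0 (Var 2).
have s5x : s5 0 = x by rewrite /s5 /s4 /s3 /s2 /update /= g1.
have s5y : s5 1 = Cons y (s 1) by rewrite /s5 /s4 /s3 /s2 /update /= g1 h1.
have [s6 [t6 [e6 h6 g6 l6]]] := rq s5 s5x.
set s7 := set_var s6 0 (ECons top (Var 0)); set s8 := set_var s7 1 (ETl (Var 1)).
do 2 eexists; split.
- do 1 apply: exec_assign_seq.
  apply: ExecSeq; first exact: e1.
  do 4 apply: exec_assign_seq.
  apply: ExecSeq; first exact: e6.
  apply: exec_assign_seq; exact: ExecAssign.
- by rewrite /update /= g6 s5y h6.
- by rewrite /update /= g6 s5y.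
- rewrite /=; lia.
Qed.

Definition if_cmd c p q :=
  Seq (push (Var 0)) (Seq c (Seq (Assign 2 (Var 0)) (Seq (Assign 0 top) (Seq pop
    (If (Var 2) p q))))).

Lemma runs_if c p q x b y T U :
  runs c x b T -> runs (if b is Nil then q else p) x y U ->
  runs (if_cmd c p q) x y (T + U + 30).
Proof.
move=> rc rb s hx.
set s0 := set_var s 1 (ECons (Var 0) (Var 1)).
have [s1 [t1 [e1 h1 g1 l1]]] := rc s0 hx.
set s2 := set_var s1 2 (Var 0); set s3 := set_var s2 0 top.
set s4 := set_var s3 1 (ETl (Var 1)).
have s4x : s4 0 = x by rewrite /s4 /s3 /s2 /update /= g1.
have s4y : s4 1 = s 1 by rewrite /s4 /s3 /s2 /update /= g1.
have s4b : s4 2 = b by rewrite /s4 /s3 /s2 /update /= h1.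
have [s6 [t6 [e6 h6 g6 l6]]] := rb s4 s4x.
exists s6, (4 + (t1 + (2 + (3 + (3 + (2 + t6)))))); split => //.
- apply: exec_assign_seq.
  apply: ExecSeq; first exact: e1.
  do 3 apply: exec_assign_seq.
  rewrite -/s2 -/s3 -/s4.
  case: b rc h1 rb s4b e6 => [|b1 b2] rc h1 rb s4b e6; first exact: ExecIfFalse.
  by apply: ExecIfTrue; rewrite //= s4b.
- by rewrite g6.
- lia.
Qed.

(* The loop works on [Cons list (Cons environment accumulator)]. *)
Definition fold_cmd p :=
  Seq (While (EHd (Var 0))
    (Seq (push (ECons (ETl (EHd (Var 0))) (EHd (ETl (Var 0)))))
    (Seq (Assign 0 (ECons (ECons (EHd (ETl (Var 0))) (ETl (ETl (Var 0))))
                          (EHd (EHd (Var 0)))))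
    (Seq p
    (Seq (Assign 0 (ECons (EHd top) (ECons (ETl top) (Var 0)))) pop)))))
  (Assign 0 (ETl (ETl (Var 0)))).

(** The body must meet the time [T] only on accumulators that come from prefixes of [l], so that a
    separate bound on their sizes is enough. *)
Lemma runs_fold p (X B : Type) (ex : X -> tree) (eb : B -> tree) (f : B -> X -> B)
    a l b T :
  (forall l1 x l2, l = l1 ++ x :: l2 ->
     runs p (Cons (Cons a (eb (foldl f b l1))) (ex x))
            (eb (f (foldl f b l1) x)) T) ->
  runs (fold_cmd p) (Cons (enc_seq ex l) (Cons a (eb b))) (eb (foldl f b l))
    (size l * (T + 50) + 10).
Proof.
move=> hp s hx; rewrite /fold_cmd.
set w := While _ _.
suff [s1 [t1 [e1 h1 g1 l1]]] : exists s1 t1,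
    [/\ exec w s s1 t1, s1 0 = Cons Nil (Cons a (eb (foldl f b l))),
        s1 1 = s 1 & t1 <= size l * (T + 50) + 3].
  do 2 eexists; split.
  - apply: ExecSeq; [exact: e1 | exact: ExecAssign].
  - by rewrite /update /= h1.
  - by rewrite /update /=.
  - rewrite /=; lia.
elim: l b s hx hp => [|x l IH] b s hx hp.
  exists s, 3; split => //.
  by apply: ExecWhileFalse; rewrite /= hx.
set s0 := set_var s 1
  (ECons (ECons (ETl (EHd (Var 0))) (EHd (ETl (Var 0)))) (Var 1)).
set s1 := set_var s0 0 (ECons (ECons (EHd (ETl (Var 0))) (ETl (ETl (Var 0))))
                          (EHd (EHd (Var 0)))).
have s1x : s1 0 = Cons (Cons a (eb b)) (ex x) by rewrite /s1 /s0 /update /= hx.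
have s1y : s1 1 = Cons (Cons (enc_seq ex l) a) (s 1).
  by rewrite /s1 /s0 /update /= hx.
have [s2 [t2 [e2 h2 g2 l2]]] := hp [::] x l erefl s1 s1x.
set s3 := set_var s2 0 (ECons (EHd top) (ECons (ETl top) (Var 0))).
set s4 := set_var s3 1 (ETl (Var 1)).
have s4x : s4 0 = Cons (enc_seq ex l) (Cons a (eb (f b x))).
  by rewrite /s4 /s3 /update /= g2 s1y h2.
have s4y : s4 1 = s 1 by rewrite /s4 /s3 /update /= g2 s1y.
have [l1 z l3 hl|s5 [t5 [e5 h5 g5 l5]]] := IH (f b x) s4 s4x.
  by apply: (hp (x :: l1) z l3); rewrite hl.
do 2 eexists; split.
- apply: ExecWhileTrue; last exact: e5; first by rewrite /= hx.
  do 2 apply: exec_assign_seq.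
  apply: ExecSeq; first exact: e2.
  apply: exec_assign_seq; exact: ExecAssign.
- exact: h5.
- by rewrite g5.
- rewrite /= mulSn; move: l5 l2; set M := _ * _; lia.
Qed.

(** * Polynomial-time functions *)

Class Enc (T : Type) := enc : T -> tree.
#[local] Instance enc_unit : Enc unit := fun=> Nil.
#[local] Instance enc_natE : Enc nat := enc_nat.
#[local] Instance enc_boolE : Enc bool := enc_bool.
#[local] Instance enc_seqE T `{Enc T} : Enc (seq T) := enc_seq enc.
#[local] Instance enc_prod A B `{Enc A} `{Enc B} : Enc (A * B) :=
  fun u => Cons (enc u.1) (enc u.2).

Definition sz T `{Enc T} (x : T) := tsize (enc x).

Lemma sz_pair A B `{Enc A} `{Enc B} (x : A) (y : B) :
  sz (x, y) = (sz x + sz y).+1.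
Proof. by []. Qed.

Lemma sz_cons T `{Enc T} (x : T) s : sz (x :: s) = (sz x + sz s).+1.
Proof. by []. Qed.

Lemma sz_cat T `{Enc T} (s1 s2 : seq T) : (sz (s1 ++ s2)).+1 = sz s1 + sz s2.
Proof. by elim: s1 => //= x s1; rewrite !sz_cons; lia. Qed.

Lemma sz_mid T `{Enc T} (x : T) s1 s2 : sz x <= sz (s1 ++ x :: s2).
Proof. by elim: s1 => [|y s1 IH]; rewrite /= sz_cons; lia. Qed.

Lemma sz_nat n : sz n = (n.*2).+1.
Proof. by rewrite /sz; elim: n => //= n; rewrite /enc /= => ->; lia. Qed.

Lemma sz_bool (b : bool) : sz b <= 3.
Proof. by case: b. Qed.

Lemma size_sz T `{Enc T} (s : seq T) : size s < sz s.
Proof. by elim: s => //= x s; rewrite sz_cons; lia. Qed.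

Lemma sz_sum T `{Enc T} (s : seq T) : sz s = (\sum_(x <- s) (sz x).+1).+1.
Proof. by elim: s => [|x s IH]; rewrite ?big_nil // big_cons sz_cons IH addnS. Qed.

Lemma sz_map_le T U `{Enc U} (f : T -> U) s M :
  (forall s1 x s2, s = s1 ++ x :: s2 -> sz (f x) <= M) ->
  sz (map f s) <= (size s * M.+1).+1.
Proof.
elim: s => [|x s IH] h //=; rewrite sz_cons mulSn.
have := h [::] x s erefl.
have : sz (map f s) <= (size s * M.+1).+1; last by move: (size s * _); lia.
by apply: IH => s1 y s2 e; apply: (h (x :: s1) y s2); rewrite e.
Qed.

(** As the base is at least 2, one exponent absorbs constant factors and summands, and these bounds
    are closed under sum, product and composition. *)
Definition pb A (b g : A -> nat) := exists c, forall a, g a <= (b a).+2 ^ c.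

Lemma leq_exp2r' a b c : a <= b -> a ^ c <= b ^ c.
Proof. by case: c => // c; rewrite leq_exp2r. Qed.

Lemma expn2_leq b c d : c <= d -> b.+2 ^ c <= b.+2 ^ d.
Proof. by move=> h; rewrite leq_exp2l. Qed.

Lemma pb_le A (b g g' : A -> nat) : (forall a, g a <= g' a) -> pb b g' -> pb b g.
Proof. by move=> h [c hc]; exists c => a; apply: leq_trans (h a) (hc a). Qed.

Lemma pb_const A (b : A -> nat) k : pb b (fun=> k).
Proof.
exists k => a; apply: leq_trans (ltnW (ltn_expl k (isT : 1 < 2))) _.
by case: k => // k; rewrite leq_exp2r.
Qed.

Lemma pb_mul A (b f g : A -> nat) : pb b f -> pb b g -> pb b (fun a => f a * g a).
Proof.
by move=> [c hc] [d hd]; exists (c + d) => a; rewrite expnD leq_mul.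
Qed.

Lemma pb_add A (b f g : A -> nat) : pb b f -> pb b g -> pb b (fun a => f a + g a).
Proof.
move=> [c hc] [d hd]; exists (c + d).+1 => a.
rewrite expnS; have := hc a; have := hd a.
have := expn2_leq (b a) (leq_addr d c); have := expn2_leq (b a) (leq_addl c d).
lia.
Qed.

Lemma pb_id A (b : A -> nat) : pb b b.
Proof. by exists 1 => a; rewrite expn1; lia. Qed.

Lemma pb_S A (b f : A -> nat) : pb b f -> pb b (fun a => (f a).+1).
Proof. move=> h; apply: pb_le (pb_add h (pb_const b 1)) => a; lia. Qed.

Lemma pb_exp A (b f : A -> nat) c : pb b f -> pb b (fun a => f a ^ c).
Proof.
move=> h; elim: c => [|c IH]; first exact: pb_const.
by apply: pb_le (pb_mul h IH) => a; rewrite expnS.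
Qed.

Lemma pb_comp A A' (h : A' -> A) (b f : A -> nat) (b' : A' -> nat) :
  pb b f -> pb b' (fun a => b (h a)) -> pb b' (fun a => f (h a)).
Proof.
move=> [c hc] hb.
by apply: pb_le (pb_exp c (pb_S (pb_S hb))) => a; apply: hc.
Qed.

Definition base A `{Enc A} (mu : A -> nat) a := mu a + sz a.

(* [f] is computable with time and output size polynomial in [mu] and the size
   of the argument. *)
Definition pt A B `{Enc A} `{Enc B} (mu : A -> nat) (f : A -> B) :=
  exists p T, [/\ forall a, runs p (enc a) (enc (f a)) (T a),
    pb (base mu) T & pb (base mu) (fun a => sz (f a))].

Ltac pb_auto := repeat first
  [ assumption | apply: pb_const | apply: pb_id | apply: pb_S | apply: pb_add
  | apply: pb_mul | apply: pb_exp ].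

Lemma pb_sz A `{Enc A} (mu : A -> nat) : pb (base mu) (fun a => sz a).
Proof. by apply: pb_le (pb_id _) => a; rewrite /base; lia. Qed.

Lemma pb_mu A `{Enc A} (mu : A -> nat) : pb (base mu) mu.
Proof. by apply: pb_le (pb_id _) => a; rewrite /base; lia. Qed.

Lemma pt_sz A B `{Enc A} `{Enc B} (mu : A -> nat) (f : A -> B) :
  pt mu f -> pb (base mu) (fun a => sz (f a)).
Proof. by case=> p [T []]. Qed.

Section Closure.
Context {A : Type} `{Enc A} (mu : A -> nat).

Lemma pt_expr B `{Enc B} (f : A -> B) e :
  (forall s a, s 0 = enc a -> eval s e = enc (f a)) ->
  pb (base mu) (fun a => sz (f a)) -> pt mu f.
Proof.
move=> he hs; exists (Assign 0 e), (fun=> (cost e).+1); split => //; last pb_auto.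
by move=> a; apply: (runs_expr (f := fun=> _)) => s; apply: he.
Qed.

Lemma pt_id : pt mu (fun a => a).
Proof. by apply: (@pt_expr _ _ _ (Var 0)) => //; apply: pb_sz. Qed.

Lemma pt_eq B `{Enc B} (f g : A -> B) : f =1 g -> pt mu f -> pt mu g.
Proof.
move=> e [p [T [h1 h2 h3]]]; exists p, T; split => // [a|].
  by rewrite -e.
by apply: pb_le h3 => a; rewrite e.
Qed.

Fixpoint quote (t : tree) : expr :=
  if t is Cons a b then ECons (quote a) (quote b) else ENil.

Lemma eval_quote s t : eval s (quote t) = t.
Proof. by elim: t => //= t1 -> t2 ->. Qed.

Lemma pt_const B `{Enc B} (b : B) : pt mu (fun=> b).
Proof.
apply: (@pt_expr _ _ _ (quote (enc b))); last exact: pb_const.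
by move=> s a _; apply: eval_quote.
Qed.

Lemma pt_comp B C `{Enc B} `{Enc C} (nu : B -> nat) (f : A -> B) (g : B -> C) :
  pt mu f -> pt nu g -> pb (base mu) (fun a => nu (f a)) ->
  pt mu (fun a => g (f a)).
Proof.
move=> [p [T [p1 p2 p3]]] [q [U [q1 q2 q3]]] hb.
have hb' : pb (base mu) (fun a => base nu (f a)) by apply: pb_add.
exists (Seq p q), (fun a => T a + U (f a)); split.
- by move=> a; apply: runs_seq.
- by apply: pb_add => //; apply: pb_comp q2 _.
- exact: pb_comp q3 _.
Qed.

Lemma pt_recode B C `{Enc B} `{Enc C} (f : A -> B) (g : A -> C) e :
  pt mu f -> (forall s a, s 0 = enc (f a) -> eval s e = enc (g a)) ->
  pb (base mu) (fun a => sz (g a)) -> pt mu g.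
Proof.
move=> [p [T [p1 p2 p3]]] he hs.
exists (Seq p (Assign 0 e)), (fun a => T a + (cost e).+1); split => //; last pb_auto.
move=> a; apply: runs_seq (p1 a) _.
by apply: (runs_expr (f := fun=> _)) => s; apply: he.
Qed.

Lemma pt_pair B C `{Enc B} `{Enc C} (f : A -> B) (g : A -> C) :
  pt mu f -> pt mu g -> pt mu (fun a => (f a, g a)).
Proof.
move=> [p [T [p1 p2 p3]]] [q [U [q1 q2 q3]]].
exists (pair_cmd p q), (fun a => T a + U a + 30); split; try by pb_auto.
by move=> a; apply: runs_pair.
Qed.

Lemma pt_fst B C `{Enc B} `{Enc C} (f : A -> B * C) :
  pt mu f -> pt mu (fun a => (f a).1).
Proof.
move=> h; apply: (pt_recode (e := EHd (Var 0)) h) => [s a /= -> //|].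
by apply: pb_le (pt_sz h) => a; case: (f a) => x y; rewrite sz_pair /=; lia.
Qed.

Lemma pt_snd B C `{Enc B} `{Enc C} (f : A -> B * C) :
  pt mu f -> pt mu (fun a => (f a).2).
Proof.
move=> h; apply: (pt_recode (e := ETl (Var 0)) h) => [s a /= -> //|].
by apply: pb_le (pt_sz h) => a; case: (f a) => x y; rewrite sz_pair /=; lia.
Qed.

Lemma pt_cons B `{Enc B} (f : A -> B) (g : A -> seq B) :
  pt mu f -> pt mu g -> pt mu (fun a => f a :: g a).
Proof.
(* A pair and a nonempty list have the same tree, so the recoding is the identity. *)
move=> hf hg; apply: (pt_recode (e := Var 0) (pt_pair hf hg)) => [s a /= -> //|].
by apply: pb_S; apply: pb_add; apply: pt_sz.
Qed.

Lemma pt_head B `{Enc B} (b : B) (f : A -> seq B) :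
  pt mu f -> pt mu (fun a => head b (f a)).
Proof.
move=> [p [T [p1 p2 p3]]].
exists (Seq p (if_cmd (Assign 0 (Var 0)) (Assign 0 (EHd (Var 0)))
                 (Assign 0 (quote (enc b))))),
  (fun a => T a + (2 + (3 + (cost (quote (enc b))).+1) + 30)); split.
- move=> a; apply: runs_seq (p1 a) _.
  apply: runs_if; first by apply: (runs_expr (f := id)).
  case: (f a) => [|x l] /=.
    apply: (runsW (leq_addl _ _)); apply: (runs_expr (f := fun=> _)) => s _.
    exact: eval_quote.
  by apply: (runsW (leq_addr _ _)); apply: (runs_expr (f := tree_hd)) => s /= ->.
- pb_auto.
- apply: pb_le (pb_add (pb_const _ (sz b)) p3) => a.
  by case: (f a) => [|x l]; rewrite ?sz_cons /=; lia.
Qed.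

Lemma pt_behead B `{Enc B} (f : A -> seq B) :
  pt mu f -> pt mu (fun a => behead (f a)).
Proof.
move=> h; apply: (pt_recode (e := ETl (Var 0)) h) => [s a /= ->|].
  by case: (f a).
by apply: pb_le (pt_sz h) => a; case: (f a) => [|x l]; rewrite ?sz_cons //=; lia.
Qed.

Lemma pt_S (f : A -> nat) : pt mu f -> pt mu (fun a => (f a).+1).
Proof.
move=> h; apply: (pt_recode (e := ECons ENil (Var 0)) h) => [s a /= -> //|].
by apply: pb_le (pb_S (pb_S (pt_sz h))) => a; rewrite !sz_nat; lia.
Qed.

Lemma pt_P (f : A -> nat) : pt mu f -> pt mu (fun a => (f a).-1).
Proof.
move=> h; apply: (pt_recode (e := ETl (Var 0)) h) => [s a /= ->|].
  by case: (f a).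
by apply: pb_le (pt_sz h) => a; rewrite !sz_nat; lia.
Qed.

Lemma pt_if B `{Enc B} (c : A -> bool) (f g : A -> B) :
  pt mu c -> pt mu f -> pt mu g -> pt mu (fun a => if c a then f a else g a).
Proof.
move=> [r [V [r1 r2 _]]] [p [T [p1 p2 p3]]] [q [U [q1 q2 q3]]].
exists (if_cmd r p q), (fun a => V a + (T a + U a) + 30); split; try by pb_auto.
- move=> a; apply: runs_if (r1 a) _.
  by case: (c a) => /=; [apply: runsW (p1 a)|apply: runsW (q1 a)]; lia.
- by apply: pb_le (pb_add p3 q3) => a; case: (c a); lia.
Qed.

Lemma pt_isnil B `{Enc B} (f : A -> seq B) : pt mu f -> pt mu (fun a => nilp (f a)).
Proof.
move=> [p [T [p1 p2 p3]]].
exists (Seq p (if_cmd (Assign 0 (Var 0)) (Assign 0 ENil)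
                 (Assign 0 (ECons ENil ENil)))), (fun a => T a + 40); split.
- move=> a; apply: runs_seq (p1 a) _.
  apply: (runsW (T := 2 + 4 + 30)) => //.
  apply: runs_if; first by apply: (runs_expr (f := id)).
  case: (f a) => [|x l] /=.
    exact: (runs_expr (f := fun=> Cons Nil Nil)).
  by apply: (runsW (T := 2)) => //; apply: (runs_expr (f := fun=> Nil)).
- pb_auto.
- by apply: pb_le (pb_const _ 3) => a; apply: sz_bool.
Qed.

End Closure.

Lemma pt_sub A A' B `{Enc A} `{Enc A'} `{Enc B} (mu : A -> nat) (nu : A' -> nat)
    (f : A -> B) (h : A' -> A) :
  pt mu f -> pt nu h -> (forall a', mu (h a') <= nu a') ->
  pt nu (fun a' => f (h a')).
Proof. by move=> hf hh le; apply: pt_comp hh hf _; apply: pb_le le (pb_mu _). Qed.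

(** Iterating a polynomial-time body can blow sizes up exponentially, as repeated squaring does;
    hence the separate bound [G] on all intermediate accumulators. *)
Lemma pt_foldl A B X `{Enc A} `{Enc B} `{Enc X} (mu : A -> nat) (l : A -> seq X)
    (b0 : A -> B) (f : A -> B -> X -> B) (G : A -> nat) :
  pt mu l -> pt mu b0 ->
  pt (fun u => mu u.1.1) (fun u : A * B * X => f u.1.1 u.1.2 u.2) ->
  pb (base mu) G ->
  (forall a l1 l2, l a = l1 ++ l2 -> sz (foldl (f a) (b0 a) l1) <= G a) ->
  pt mu (fun a => foldl (f a) (b0 a) (l a)).
Proof.
move=> hl hb [p [T [p1 [c hc] p3]]] hG le.
have [q [U [q1 q2 q3]]] := pt_pair hl (pt_pair (pt_id mu) hb).
pose (D := fun a => base mu a + (sz a + G a + sz (l a)).+2).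
have hD : pb (base mu) D by apply: pb_add; pb_auto; [apply: pb_sz | apply: pt_sz].
exists (Seq q (fold_cmd p)),
  (fun a => U a + (size (l a) * ((D a).+2 ^ c + 50) + 10)); split.
- move=> a; apply: runs_seq (q1 a) _.
  apply: (runs_fold (l := l a) (b := b0 a) (f := f a)) => l1 x l2 e.
  apply: runsW (p1 (a, foldl (f a) (b0 a) l1, x)).
  apply: leq_trans (hc _) _; apply: leq_exp2r'.
  rewrite /base /= !sz_pair /D.
  have := le a l1 (x :: l2) e; have : sz x <= sz (l a).
    by rewrite e; apply: sz_mid.
  rewrite /base; lia.
- apply: pb_add => //; pb_auto.
  by apply: pb_le (pt_sz hl) => a; apply: ltnW (size_sz _).
- by apply: pb_le hG => a; apply: (le a _ [::]); rewrite cats0.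
Qed.

Ltac pt_lib := fail.

Ltac pt_step := cbv beta; first [ assumption | match goal with
  | |- pt _ (fun a => a) => apply: pt_id
  | |- pt _ (fun _ => ?c) => apply: pt_const
  | |- pt _ fst => exact: (pt_fst (pt_id _))
  | |- pt _ snd => exact: (pt_snd (pt_id _))
  | |- pt _ (fun a => fst (@?f a)) => apply: pt_fst
  | |- pt _ (fun a => snd (@?f a)) => apply: pt_snd
  | |- pt _ (fun a => (@?f a, @?g a)) => apply: pt_pair
  | |- pt _ (fun a => (@?f a) :: (@?g a)) => apply: pt_cons
  | |- pt _ (fun a => S (@?f a)) => apply: pt_S
  | |- pt _ (fun a => predn (@?f a)) => apply: pt_P
  | |- pt _ (fun a => behead (@?f a)) => apply: pt_behead
  | |- pt _ (fun a => head _ (@?f a)) => apply: pt_head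
  | |- pt _ (fun a => nilp (@?f a)) => apply: pt_isnil
  | H : pt _ ?u |- pt _ (fun x => ?u (@?h x)) =>
      apply: (pt_sub (h := h) H); [ | by [] ]
  end | pt_lib | apply: pt_if ].

Ltac pt_auto := repeat pt_step.

(** A list of units is encoded by the very tree of its length, so a number can act as the loop
    counter of a fold. *)
Lemma pt_nseq A `{Enc A} (mu : A -> nat) n : pt mu n -> pt mu (fun a => nseq (n a) tt).
Proof.
have e m : enc (nseq m tt) = enc m by elim: m => //= m; rewrite /enc /= => ->.
move=> h; apply: (pt_recode (e := Var 0) h) => [s a /= ->|]; first by rewrite e.
by apply: pb_le (pt_sz h) => a; rewrite /sz e.
Qed.

Lemma foldl_nseq B (f : B -> B) b n :
  foldl (fun b (_ : unit) => f b) b (nseq n tt) = iter n f b.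
Proof. by elim: n b => //= n IH b; rewrite IH -iterSr. Qed.

Lemma pt_iter A B `{Enc A} `{Enc B} (mu : A -> nat) (n : A -> nat) (b : A -> B)
    (f : A -> B -> B) (G : A -> nat) :
  pt mu n -> pt mu b -> pt (fun u => mu u.1) (fun u : A * B => f u.1 u.2) ->
  pb (base mu) G -> (forall a j, j <= n a -> sz (iter j (f a) (b a)) <= G a) ->
  pt mu (fun a => iter (n a) (f a) (b a)).
Proof.
move=> hn hb hf hG le.
apply: (pt_eq (f := fun a => foldl (fun b (_ : unit) => f a b) (b a) (nseq (n a) tt))).
  by move=> a; rewrite foldl_nseq.
apply: pt_foldl (pt_nseq hn) hb _ hG _.
  by apply: (pt_sub (f := fun u => f u.1 u.2) (h := fun u => u.1) hf); pt_auto.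
move=> a l1 l2 e.
have el : l1 = nseq (size l1) tt by elim: (l1) => //= [[]] l <-.
rewrite el foldl_nseq; apply: le.
by have := congr1 size e; rewrite size_nseq size_cat => ->; apply: leq_addr.
Qed.

Lemma foldl_cons_rev X (s : seq X) : foldl (fun s x => x :: s) [::] s = rev s.
Proof. by rewrite -[s in LHS]revK foldl_rev; elim: (rev s) => //= x r ->. Qed.

Lemma pt_rev A X `{Enc A} `{Enc X} (mu : A -> nat) (l : A -> seq X) :
  pt mu l -> pt mu (fun a => rev (l a)).
Proof.
move=> h; apply: (pt_eq (f := fun a => foldl (fun s x => x :: s) [::] (l a))).
  by move=> a; apply: foldl_cons_rev.
apply: pt_foldl; [pt_auto..|exact: pt_sz h|].
move=> a l1 l2 /= ->.
by rewrite foldl_cons_rev !sz_sum big_rev big_cat /=; lia.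
Qed.

Lemma pt_foldr A B X `{Enc A} `{Enc B} `{Enc X} (mu : A -> nat) (l : A -> seq X)
    (b0 : A -> B) (f : A -> X -> B -> B) (G : A -> nat) :
  pt mu l -> pt mu b0 ->
  pt (fun u => mu u.1.1) (fun u : A * B * X => f u.1.1 u.2 u.1.2) ->
  pb (base mu) G ->
  (forall a l1 l2, l a = l1 ++ l2 -> sz (foldr (f a) (b0 a) l2) <= G a) ->
  pt mu (fun a => foldr (f a) (b0 a) (l a)).
Proof.
move=> hl hb hf hG le.
apply: (pt_eq (f := fun a => foldl (fun b x => f a x b) (b0 a) (rev (l a)))).
  by move=> a; rewrite foldl_rev.
apply: pt_foldl (pt_rev hl) hb hf hG _ => a l1 l2 e.
rewrite -[l1]revK foldl_rev; apply: (le a (rev l2)).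
by rewrite -rev_cat -e revK.
Qed.

(** * List operations *)

Section Lists.
Context {A X : Type} `{Enc A} `{Enc X} (mu : A -> nat).
Implicit Types (l : A -> seq X) (p : A -> X -> bool).

Lemma pt_map Y `{Enc Y} (f : A -> X -> Y) l :
  pt mu l -> pt (fun u => mu u.1) (fun u : A * X => f u.1 u.2) ->
  pt mu (fun a => map (f a) (l a)).
Proof.
move=> hl hf; have [c hc] := pt_sz hf.
apply: (pt_eq (f := fun a => foldr (fun x s => f a x :: s) [::] (l a))) => //.
pose (D := fun a => base mu a + (sz (l a)).+1).
have hD : pb (base mu) D by apply: pb_add; pb_auto; apply: pt_sz.
apply: (pt_foldr (G := fun a => (sz (l a) * ((D a).+2 ^ c).+1).+1)) => //.
- pt_auto.
- apply: pt_cons; last pt_auto.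
  by apply: (pt_sub (f := fun u => f u.1 u.2) (h := fun u => (u.1.1, u.2)) hf); pt_auto.
- by pb_auto; apply: pt_sz.
- move=> a l1 l2 e; rewrite -/(map (f a) l2).
  have les : size l2 <= sz (l a).
    by apply: leq_trans (ltnW (size_sz _)); rewrite e size_cat leq_addl.
  apply: (leq_trans (n := (size l2 * ((D a).+2 ^ c).+1).+1)); last first.
    by rewrite ltnS leq_mul2r les orbT.
  apply: sz_map_le => l3 x l4 e'.
  apply: leq_trans (hc (a, x)) _; apply: leq_exp2r'; rewrite /base /= sz_pair /D /base.
  have : sz x <= sz (l a); last by lia.
  by rewrite e e' catA; apply: sz_mid.
Qed.

Lemma pt_cat l l' : pt mu l -> pt mu l' -> pt mu (fun a => l a ++ l' a).
Proof.
move=> h h'; apply: (pt_eq (f := fun a => foldr cons (l' a) (l a))).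
  by move=> a; elim: (l a) => //= x s ->.
apply: pt_foldr; [pt_auto..|exact: pb_add (pt_sz h) (pt_sz h')|].
move=> a l1 l2 /= ->; rewrite (_ : foldr _ _ _ = l2 ++ l' a); last first.
  by elim: l2 => //= x s ->.
rewrite !sz_sum !big_cat /=; lia.
Qed.

Lemma pt_filter p l :
  pt mu l -> pt (fun u => mu u.1) (fun u : A * X => p u.1 u.2) ->
  pt mu (fun a => filter (p a) (l a)).
Proof.
move=> h hp.
apply: (pt_eq (f := fun a => foldr (fun x s => if p a x then x :: s else s) [::] (l a))).
  by [].
apply: pt_foldr; [pt_auto..| |exact: pt_sz h|].
  apply: pt_if; [|pt_auto..].
  by apply: (pt_sub (f := fun u => p u.1 u.2) (h := fun u => (u.1.1, u.2)) hp); pt_auto.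
move=> a l1 l2 /= ->; rewrite -/(filter _ _) !sz_sum big_cat big_filter /=.
rewrite [X in _ <= (_ + X).+1](bigID (p a)) /=; lia.
Qed.

Lemma pt_all p l :
  pt mu l -> pt (fun u => mu u.1) (fun u : A * X => p u.1 u.2) ->
  pt mu (fun a => all (p a) (l a)).
Proof.
move=> h hp.
apply: (pt_eq (f := fun a => foldr (fun x b => if p a x then b else false) true (l a))).
  by [].
apply: pt_foldr; [pt_auto..| |exact: (pb_const _ 3)|by move=> *; apply: sz_bool].
apply: pt_if; [|pt_auto..].
by apply: (pt_sub (f := fun u => p u.1 u.2) (h := fun u => (u.1.1, u.2)) hp); pt_auto.
Qed.

Lemma pt_has p l :
  pt mu l -> pt (fun u => mu u.1) (fun u : A * X => p u.1 u.2) ->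
  pt mu (fun a => has (p a) (l a)).
Proof.
move=> h hp.
apply: (pt_eq (f := fun a => foldr (fun x b => if p a x then true else b) false (l a))).
  by [].
apply: pt_foldr; [pt_auto..| |exact: (pb_const _ 3)|by move=> *; apply: sz_bool].
apply: pt_if; [|pt_auto..].
by apply: (pt_sub (f := fun u => p u.1 u.2) (h := fun u => (u.1.1, u.2)) hp); pt_auto.
Qed.

Lemma pt_count p l :
  pt mu l -> pt (fun u => mu u.1) (fun u : A * X => p u.1 u.2) ->
  pt mu (fun a => count (p a) (l a)).
Proof.
move=> h hp.
apply: (pt_eq (f := fun a => foldr (fun x c => if p a x then c.+1 else c) 0 (l a))).
  by move=> a; elim: (l a) => //= x s ->; case: (p a x).
apply: pt_foldr; [pt_auto..| |exact: pb_add (pt_sz h) (pt_sz h)|].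
  apply: pt_if; [|pt_auto..].
  by apply: (pt_sub (f := fun u => p u.1 u.2) (h := fun u => (u.1.1, u.2)) hp); pt_auto.
move=> a l1 l2 /= ->; rewrite sz_nat.
set c := foldr _ _ _.
have hc : c <= size l2 by rewrite /c; elim: (l2) => //= x s IH; case: (p a x); lia.
apply: (leq_trans (n := (size (l1 ++ l2)).*2.+1)); first by rewrite size_cat; lia.
apply: (leq_trans (n := (sz (l1 ++ l2)).*2)); last by lia.
by rewrite ltn_double size_sz.
Qed.

Lemma pt_drop n l : pt mu n -> pt mu l -> pt mu (fun a => drop (n a) (l a)).
Proof.
have e j s : iter j behead s = drop j s :> seq X.
  elim: j s => [|j IH] s; first by rewrite drop0.
  by rewrite iterSr IH; case: s.
move=> hn hl; apply: (pt_eq (f := fun a => iter (n a) behead (l a))) => [a //|].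
apply: pt_iter; [pt_auto..|exact: pt_sz hl|].
move=> a j _; rewrite e -{2}(cat_take_drop j (l a)) !sz_sum big_cat /=; lia.
Qed.

Lemma pt_nth x0 n l : pt mu n -> pt mu l -> pt mu (fun a => nth x0 (l a) (n a)).
Proof.
move=> hn hl; apply: (pt_eq (f := fun a => head x0 (drop (n a) (l a)))).
  by move=> a; rewrite -nth0 nth_drop addn0.
by apply: pt_head; apply: pt_drop.
Qed.

(** Here [k] is a constant, so the program is unrolled [k] times instead of looping. *)
Lemma pt_take (x0 : X) k l : pt mu l -> pt mu (fun a => take k (l a)).
Proof.
elim: k l => [|k IH] l hl.
  by apply: (pt_eq (f := fun=> [::])) => [a|]; [rewrite take0 | apply: pt_const].
apply: (pt_eq (f := fun a => if nilp (l a) then [::] else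
                    head x0 (l a) :: take k (behead (l a)))).
  by move=> a; case: (l a).
by pt_auto; apply: IH; pt_auto.
Qed.

End Lists.

Lemma sz_flatten X `{Enc X} (l : seq (seq X)) : sz (flatten l) <= sz l.
Proof.
elim: l => //= x s IH; rewrite sz_cons.
by rewrite -ltnS sz_cat; lia.
Qed.

Lemma pt_flatten A X `{Enc A} `{Enc X} (mu : A -> nat) (l : A -> seq (seq X)) :
  pt mu l -> pt mu (fun a => flatten (l a)).
Proof.
move=> h; apply: pt_foldr; [pt_auto..| |exact: pt_sz h|].
  by apply: pt_cat; pt_auto.
move=> a l1 l2 /= ->; apply: leq_trans (sz_flatten l2) _.
by elim: l1 => [|x l1 IH] //=; rewrite sz_cons; lia.
Qed.

(** * Unary arithmetic and Boolean operations *)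

Section Arith.
Context {A : Type} `{Enc A} (mu : A -> nat).
Implicit Types (f g : A -> nat) (b c : A -> bool).

(** In unary the output size dominates the value, so any computed number may serve as a loop bound
    or enter a size bound. *)
Lemma pb_nat f : pt mu f -> pb (base mu) f.
Proof. by move=> /pt_sz; apply: pb_le => a; rewrite sz_nat; lia. Qed.

Lemma pt_addn f g : pt mu f -> pt mu g -> pt mu (fun a => f a + g a).
Proof.
move=> hf hg; apply: (pt_eq (f := fun a => iter (f a) succn (g a))).
  by move=> a; rewrite iter_succn addnC.
apply: pt_iter; [pt_auto..|exact: (pb_S (pb_mul (pb_const _ 2)
  (pb_add (pb_nat hf) (pb_nat hg))))|].
by move=> a j hj /=; rewrite iter_succn sz_nat; lia.
Qed.

Lemma pt_subn f g : pt mu f -> pt mu g -> pt mu (fun a => f a - g a).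
Proof.
move=> hf hg; apply: (pt_eq (f := fun a => iter (g a) predn (f a))).
  by move=> a; rewrite iter_predn.
apply: pt_iter; [pt_auto..|exact: (pb_S (pb_mul (pb_const _ 2) (pb_nat hf)))|].
by move=> a j hj /=; rewrite iter_predn sz_nat; lia.
Qed.

Lemma pt_eq0 f : pt mu f -> pt mu (fun a => f a == 0).
Proof.
move=> h; apply: (pt_eq (f := fun a => nilp (nseq (f a) tt))).
  by move=> a; rewrite /nilp size_nseq.
by apply: pt_isnil; apply: pt_nseq.
Qed.

Lemma pt_leq f g : pt mu f -> pt mu g -> pt mu (fun a => f a <= g a).
Proof. by move=> hf hg; apply: pt_eq0; apply: pt_subn. Qed.

Lemma pt_eqn f g : pt mu f -> pt mu g -> pt mu (fun a => f a == g a).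
Proof.
move=> hf hg.
apply: (pt_eq (f := fun a => if f a <= g a then g a <= f a else false)).
  by move=> a; rewrite eqn_leq.
by apply: pt_if; [apply: pt_leq..|apply: pt_const].
Qed.

Lemma pt_negb b : pt mu b -> pt mu (fun a => ~~ b a).
Proof.
move=> h; apply: (pt_eq (f := fun a => if b a then false else true)) => [a //|].
by pt_auto.
Qed.

Lemma pt_andb b c : pt mu b -> pt mu c -> pt mu (fun a => b a && c a).
Proof.
move=> hb hc; apply: (pt_eq (f := fun a => if b a then c a else false)) => [a //|].
by pt_auto.
Qed.

Lemma pt_orb b c : pt mu b -> pt mu c -> pt mu (fun a => b a || c a).
Proof.
move=> hb hc; apply: (pt_eq (f := fun a => if b a then true else c a)) => [a //|].
by pt_auto.
Qed.

Lemma pt_implb b c : pt mu b -> pt mu c -> pt mu (fun a => b a ==> c a).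
Proof.
move=> hb hc; apply: (pt_eq (f := fun a => if b a then c a else true)) => [a //|].
by pt_auto.
Qed.

Lemma pt_addb b c : pt mu b -> pt mu c -> pt mu (fun a => b a (+) c a).
Proof.
move=> hb hc; apply: (pt_eq (f := fun a => if b a then ~~ c a else c a)) => [a|].
  by case: (b a).
by apply: pt_if => //; apply: pt_negb.
Qed.

Lemma pt_eqb b c : pt mu b -> pt mu c -> pt mu (fun a => b a == c a).
Proof.
move=> hb hc; apply: (pt_eq (f := fun a => if b a then c a else ~~ c a)).
  by move=> a; case: (b a); case: (c a).
by apply: pt_if; pt_auto; apply: pt_negb.
Qed.

End Arith.

Ltac pt_arith := match goal with
  | |- pt _ (fun a => leq (@?f a) (@?g a)) => apply: pt_leq
  | |- pt _ (fun a => addn (@?f a) (@?g a)) => apply: pt_addn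
  | |- pt _ (fun a => subn (@?f a) (@?g a)) => apply: pt_subn
  | |- pt _ (fun a => @eq_op _ (@?f a) (@?g a)) =>
         first [apply: pt_eqn | apply: pt_eqb]
  | |- pt _ (fun a => addb (@?f a) (@?g a)) => apply: pt_addb
  | |- pt _ (fun a => negb (@?f a)) => apply: pt_negb
  | |- pt _ (fun a => andb (@?f a) (@?g a)) => apply: pt_andb
  | |- pt _ (fun a => orb (@?f a) (@?g a)) => apply: pt_orb
  | |- pt _ (fun a => implb (@?f a) (@?g a)) => apply: pt_implb
  | |- pt _ (fun a => map _ (@?g a)) => apply: pt_map
  | |- pt _ (fun a => filter _ (@?g a)) => apply: pt_filter
  | |- pt _ (fun a => all _ (@?g a)) => apply: pt_all
  | |- pt _ (fun a => has _ (@?g a)) => apply: pt_has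
  | |- pt _ (fun a => count _ (@?g a)) => apply: pt_count
  | |- pt _ (fun a => cat (@?f a) (@?g a)) => apply: pt_cat
  | |- pt _ (fun a => flatten (@?g a)) => apply: pt_flatten
  | |- pt _ (fun a => rev (@?g a)) => apply: pt_rev
  | |- pt _ (fun a => drop (@?f a) (@?g a)) => apply: pt_drop
  | |- pt _ (fun a => nth _ (@?f a) (@?g a)) => apply: pt_nth
  end.
Ltac pt_lib ::= pt_arith.

(** A unary number can only be walked through; parity and half are updated together, one unit at a
    time. *)
Lemma pt_odd_half A `{Enc A} (mu : A -> nat) f : pt mu f ->
  pt mu (fun a => (odd (f a), half (f a))).
Proof.
move=> h; pose (step := fun (u : bool * nat) =>
  if u.1 then (false, u.2.+1) else (true, u.2)).
have e n : iter n step (false, 0) = (odd n, half n).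
  by elim: n => //= n ->; rewrite /step /= uphalf_half; case: (odd n).
apply: (pt_eq (f := fun a => iter (f a) step (false, 0))) => [a //|].
apply: pt_iter; [pt_auto..| |
  exact: (pb_add (pb_const _ 5) (pb_mul (pb_const _ 2) (pb_nat h)))|].
  by rewrite /step; pt_auto.
move=> a j hj; rewrite e sz_pair sz_nat.
by have := sz_bool (odd j); lia.
Qed.

Lemma pt_odd A `{Enc A} (mu : A -> nat) f : pt mu f -> pt mu (fun a => odd (f a)).
Proof. by move=> /pt_odd_half/pt_fst. Qed.

Lemma pt_half A `{Enc A} (mu : A -> nat) f : pt mu f -> pt mu (fun a => half (f a)).
Proof. by move=> /pt_odd_half/pt_snd. Qed.

Lemma sz_iota m n : sz (iota m n) <= (n * (m + n).+1.*2).+1.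
Proof.
elim: n m => //= n IH m; rewrite sz_cons sz_nat.
by have := IH m.+1; rewrite addSnnS mulSn; lia.
Qed.

Lemma pt_iota0 A `{Enc A} (mu : A -> nat) f : pt mu f -> pt mu (fun a => iota 0 (f a)).
Proof.
move=> h; pose (step := fun s : seq nat => (if nilp s then 0 else (head 0 s).+1) :: s).
have e n : iter n step [::] = rev (iota 0 n).
  elim: n => [//|n]; rewrite iterS => ->; rewrite -[n.+1]addn1 iotaD rev_cat /= /step.
  by case: n => [//|n]; rewrite -[n.+1]addn1 iotaD rev_cat /= add0n addn1.
apply: (pt_eq (f := fun a => rev (iter (f a) step [::]))).
  by move=> a; rewrite e revK.
apply: pt_rev; apply: pt_iter; [pt_auto..| |
  exact: (pb_S (pb_mul (pb_nat h) (pb_mul (pb_const _ 2) (pb_S (pb_nat h)))))|].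
  by rewrite /step; pt_auto.
move=> a j hj; rewrite e sz_sum big_rev -sz_sum.
apply: leq_trans (sz_iota 0 j) _; rewrite ltnS leq_mul //; lia.
Qed.

(** The entries at even and at odd positions: the two restrictions of a truth table according to its
    first, least significant, wire. *)
Definition split_bits (t : seq bool) : seq bool * seq bool :=
  foldr (fun x r => (x :: r.2, r.1)) ([::], [::]) t.

Lemma nth_split_bits t i :
  nth false (split_bits t).1 i = nth false t i.*2 /\
  nth false (split_bits t).2 i = nth false t i.*2.+1.
Proof.
elim: t i => [|x t IH] i /=; first by rewrite !nth_nil.
case: i => [|i] /=; first by have [-> _] := IH 0.
by have [_ ->] := IH i; have [-> _] := IH i.+1.
Qed.

Lemma size_split_bits t : size (split_bits t).1 + size (split_bits t).2 = size t.
Proof. by elim: t => //= x t <-; rewrite addSn addnC. Qed.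

Lemma sz_bits (s : seq bool) : sz s <= (4 * size s).+1.
Proof. by elim: s => //= b s IH; rewrite sz_cons; have := sz_bool b; lia. Qed.

Lemma pt_split_bits A `{Enc A} (mu : A -> nat) f :
  pt mu f -> pt mu (fun a => split_bits (f a)).
Proof.
move=> hf; apply: pt_foldr; [pt_auto..|
  exact: (pb_S (pb_S (pb_S (pb_mul (pb_const _ 4) (pt_sz hf)))))|].
move=> b l1 l2 /= hl; rewrite -/(split_bits l2).
apply: (leq_trans (n := 4 * size l2 + 3)); last first.
  rewrite -[X in _ <= X]addn3 leq_add2r leq_mul2l /=.
  by apply: leq_trans (ltnW (size_sz _)); rewrite hl size_cat leq_addl.
have := size_split_bits l2; case: (split_bits l2) => x y /=; rewrite sz_pair.
by have := sz_bits x; have := sz_bits y; lia.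
Qed.

(** The unary form of [bits_val] may be exponential in the number of bits, so the index is never
    computed: each bit selects one half of the remaining table. *)
Lemma pt_lookup A `{Enc A} (mu : A -> nat) (t bs : A -> seq bool) :
  pt mu t -> pt mu bs -> pt mu (fun a => nth false (t a) (bits_val (bs a))).
Proof.
move=> ht hbs.
pose (step := fun (t : seq bool) (b : bool) =>
  if b then (split_bits t).2 else (split_bits t).1).
have e bs0 : forall t0, head false (foldl step t0 bs0) = nth false t0 (bits_val bs0).
  elim: bs0 => [|b bs0 IH] t0 /=; first by rewrite nth0.
  rewrite IH /step; have [e1 e2] := nth_split_bits t0 (bits_val bs0).
  by case: b; rewrite ?e1 ?e2.
apply: (pt_eq (f := fun a => head false (foldl step (t a) (bs a)))) => [a //|].
apply: pt_head.
apply: pt_foldl; [pt_auto..| |exact: (pb_S (pb_mul (pb_const _ 4) (pt_sz ht)))|].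
  by rewrite /step; pt_auto; apply: pt_split_bits; pt_auto.
move=> a l1 l2 /= _; apply: leq_trans (sz_bits _) _; rewrite ltnS leq_mul2l /=.
apply: leq_trans (ltnW (size_sz _)); elim: l1 (t a) => //= b l1 IH t0.
apply: leq_trans (IH _) _; have := size_split_bits t0; rewrite /step.
by case: b; lia.
Qed.

Ltac pt_arith2 := first [ pt_arith | match goal with
  | |- pt _ (fun a => odd (@?f a)) => apply: pt_odd
  | |- pt _ (fun a => half (@?f a)) => apply: pt_half
  | |- pt _ (fun a => iota 0 (@?f a)) => apply: pt_iota0
  | |- pt _ (fun a => nth false (@?t a) (bits_val (@?f a))) => apply: pt_lookup
  end ].
Ltac pt_lib ::= pt_arith2.

(** * The algorithm *)

(* Gates without the bounds on arity, wires and table length. *)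
Notation rgate := (seq nat * seq bool)%type.
(* A system of affine constraints: the pair at position [i] is [(r, b)] when the
   [i]-th unknown is the [r]-th class variable plus [b].  Unknown 0 is the
   constant [false] and unknown [i.+1] is input bit [i].  The first component
   bounds the number of class variables. *)
Notation system := (nat * seq (nat * bool))%type.

Section Algorithm.
Variable K : nat.
Implicit Types (g : rgate) (gs : seq rgate) (S : seq nat) (s : system).

(** With [K = k - 2] at most two wires are left over; they are the unknowns on which the gate still
    depends. *)
Definition fixed g := take K g.1.
Definition covered S g := all (fun i => has (fun j => i == j) S) (fixed g).
Definition ncovered S gs := count (covered S) gs.

Definition best S gs := foldl (fun S' g =>
  if ncovered S' gs < ncovered (S ++ fixed g) gs then S ++ fixed g else S') S gs.
(** The list folded over is only a counter: while fewer than [3 * n] gates are covered, a round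
    covers a new one ([best_gain]), so as many rounds as gates suffice. *)
Definition greedy n gs := foldl (fun S _ =>
  if n + n + n <= ncovered S gs then S else best S gs) [::] gs.

Definition lit s i := nth (0, false) s.2 i.
(** The equation [(X p.1 + p.2) + (X q.1 + q.2) = c] is solved for [X p.1], which is then
    substituted everywhere; one class disappears. *)
Definition merge (p q : nat * bool) c s : system :=
  (s.1.-1, [seq if l.1 == p.1 then (q.1, l.2 (+) (p.2 (+) q.2 (+) c)) else l
           | l <- s.2]).
(** The empty list records a contradiction, so that dead branches vanish under [flatten]. *)
Definition impose u v c s : seq system :=
  if (lit s u).1 == (lit s v).1 then
    if (lit s u).2 (+) (lit s v).2 == c then [:: s] else [::]
  else [:: merge (lit s u) (lit s v) c s].

Definition unconstrained n : system := (n.+1, [seq (i, false) | i <- iota 0 n.+1]).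
Definition branch n S := foldl (fun ss v =>
  flatten [seq impose v.+1 0 false s ++ impose v.+1 0 true s | s <- ss])
  [:: unconstrained n] S.

(** Meaningful when unknown [i] shares the class of unknown 0. The variable of that class is not
    normalised to [false], so both offsets enter. *)
Definition const_val s i := (lit s i).2 (+) (lit s 0).2.
(** The default 0 is essential: a missing wire becomes unknown 0, the constant [false]. *)
Definition free_wire g j := nth 0 [seq i.+1 | i <- drop K g.1] j.
Definition output g s (ab : bool * bool) :=
  nth false g.2
    (bits_val ([seq const_val s i.+1 | i <- fixed g] ++ [:: ab.1; ab.2])).

Definition bool_pairs : seq (bool * bool) :=
  [:: (false, false); (false, true); (true, false); (true, true)].
Definition candidates y g s := [seq ab <- bool_pairs |
  [&& ((lit s (free_wire g 0)).1 == (lit s 0).1) ==>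
        (ab.1 == const_val s (free_wire g 0)),
      ((lit s (free_wire g 1)).1 == (lit s 0).1) ==>
        (ab.2 == const_val s (free_wire g 1)),
      ((lit s (free_wire g 0)).1 == (lit s (free_wire g 1)).1) ==>
        (ab.1 (+) ab.2 == (lit s (free_wire g 0)).2 (+) (lit s (free_wire g 1)).2)
    & output g s ab == y]].

(** The requirement that [g] output [y] is relaxed to one equation satisfied by all candidates and
    not yet decided by the system; if there is none, the system is kept. No compatible input is
    lost, and a system never yields more than one successor. *)
Definition next y g s : seq system :=
  if nilp (candidates y g s) then [::] else
  if ((lit s (free_wire g 0)).1 != (lit s 0).1) &&
     all (fun ab => ab.1 == (head (false, false) (candidates y g s)).1)
         (candidates y g s)
  then impose (free_wire g 0) 0 (head (false, false) (candidates y g s)).1 s else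
  if ((lit s (free_wire g 1)).1 != (lit s 0).1) &&
     all (fun ab => ab.2 == (head (false, false) (candidates y g s)).2)
         (candidates y g s)
  then impose (free_wire g 1) 0 (head (false, false) (candidates y g s)).2 s else
  if ((lit s (free_wire g 0)).1 != (lit s (free_wire g 1)).1) &&
     all (fun ab => ab.1 (+) ab.2 ==
                    (head (false, false) (candidates y g s)).1 (+)
                    (head (false, false) (candidates y g s)).2)
         (candidates y g s)
  then impose (free_wire g 0) (free_wire g 1)
         ((head (false, false) (candidates y g s)).1 (+)
          (head (false, false) (candidates y g s)).2) s
  else [:: s].

(* The sums of [2 ^ i] over two lists of exponents are compared bit by bit,
   starting from the least significant one: [r.1] holds the two carries. *)
Definition phi_step (e0 e1 : seq nat) (r : nat * nat * bool) j : nat * nat * bool :=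
  ((half (r.1.1 + count (fun i => i == j) e0),
    half (r.1.2 + count (fun i => i == j) e1)),
   if odd (r.1.1 + count (fun i => i == j) e0) ==
      odd (r.1.2 + count (fun i => i == j) e1)
   then r.2 else odd (r.1.2 + count (fun i => i == j) e1)).
Definition phi_run N e0 e1 := foldl (phi_step e0 e1) (0, 0, true) (iota 0 N).
Definition phi_leq N e0 e1 :=
  if (phi_run N e0 e1).1.1 == (phi_run N e0 e1).1.2 then (phi_run N e0 e1).2
  else (phi_run N e0 e1).1.1 <= (phi_run N e0 e1).1.2.

Definition nexts y g (ss : seq system) := flatten [seq next y g s | s <- ss].
Definition exponents (ss : seq system) := [seq s.1 | s <- ss].

(** All exponents are at most [n.+1], so [n.+2] digits and the final carries settle the comparison.
    The bit of an uncovered gate is arbitrary and imposes nothing. *)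
Definition choose n S (r : seq bool * seq system) g :=
  if covered S g then
    if phi_leq n.+2 (exponents (nexts false g r.2)) (exponents (nexts true g r.2))
    then (false :: r.1, nexts false g r.2) else (true :: r.1, nexts true g r.2)
  else (false :: r.1, r.2).

Definition run n S gs := foldl (choose n S) ([::], branch n S) gs.
Definition solve n gs := rev (run n (greedy n gs) gs).1.

End Algorithm.

(** * Running time *)

Section Programs.
Variable K : nat.
Context {A : Type} `{Enc A} (mu : A -> nat).

Lemma pt_fixed (g : A -> rgate) : pt mu g -> pt mu (fun a => fixed K (g a)).
Proof. by move=> h; apply: (pt_take 0); pt_auto. Qed.

End Programs.

Ltac pt_alg1 := match goal with
  | |- pt _ (fun a => fixed _ (@?g a)) => apply: pt_fixed
  end.
Ltac pt_lib ::= first [pt_arith2 | pt_alg1].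

Lemma pt_covered K A `{Enc A} (mu : A -> nat) S (g : A -> rgate) :
  pt mu S -> pt mu g -> pt mu (fun a => covered K (S a) (g a)).
Proof. by move=> hS hg; rewrite /covered; pt_auto. Qed.

Lemma pt_ncovered K A `{Enc A} (mu : A -> nat) S (gs : A -> seq rgate) :
  pt mu S -> pt mu gs -> pt mu (fun a => ncovered K (S a) (gs a)).
Proof. by move=> hS hg; apply: pt_count => //; apply: pt_covered; pt_auto. Qed.

Lemma sz_take X `{Enc X} k (s : seq X) : sz (take k s) <= sz s.
Proof. by rewrite -{2}(cat_take_drop k s) !sz_sum big_cat /=; lia. Qed.

Lemma sz_fixed K (g : rgate) : sz (fixed K g) <= sz g.
Proof.
apply: leq_trans (sz_take _ _) _.
by case: g => w t; rewrite sz_pair /=; lia.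
Qed.

(** The accumulator is always [S] or [S] extended by the wires of a single gate, so sizes do not add
    up along the fold. *)
Lemma sz_best_fold K S gs l : (forall g, g \in l -> g \in gs) ->
  sz (foldl (fun S' g =>
    if ncovered K S' gs < ncovered K (S ++ fixed K g) gs then S ++ fixed K g
    else S') S l) <= sz S + sz gs.
Proof.
set F := fun _ _ => _ => sub.
have : sz (foldl F S l) <= sz S + sz gs /\ True.
  elim/last_ind: l sub => [|l g IH] sub; first by split => //; apply: leq_addr.
  have [|IH1 _] := IH; first by move=> g' hg'; apply: sub; rewrite mem_rcons inE hg' orbT.
  split => //; rewrite -cats1 foldl_cat /= /F; case: ifP => // _.
  have le : sz (fixed K g) <= sz gs.
    apply: leq_trans (sz_fixed K g) _.
    have /splitPr[l1 l2] : g \in gs by apply: sub; rewrite mem_rcons mem_head.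
    exact: sz_mid.
  by apply: ltnW; rewrite sz_cat leq_add2l.
by case.
Qed.

Lemma sz_best K S gs : sz (best K S gs) <= sz S + sz gs.
Proof. exact: sz_best_fold. Qed.

Lemma pt_best K A `{Enc A} (mu : A -> nat) S (gs : A -> seq rgate) :
  pt mu S -> pt mu gs -> pt mu (fun a => best K (S a) (gs a)).
Proof.
move=> hS hg; apply: pt_foldl => //; last 1 first.
- move=> a l1 l2 e /=; apply: sz_best_fold => g hgl.
  by rewrite e mem_cat hgl.
- cbv beta; apply: pt_if; [apply: pt_leq; [apply: pt_S|]; apply: pt_ncovered | |];
  pt_auto.
- exact: pb_add (pt_sz hS) (pt_sz hg).
Qed.

Lemma pt_greedy K A `{Enc A} (mu : A -> nat) n (gs : A -> seq rgate) :
  pt mu n -> pt mu gs -> pt mu (fun a => greedy K (n a) (gs a)).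
Proof.
move=> hn hg.
apply: (pt_foldl (G := fun a => 1 + sz (gs a) * sz (gs a))) => //; last 1 first.
- move=> a l1 l2 e /=.
  have h : sz (foldl (fun S (_ : rgate) =>
      if n a + n a + n a <= ncovered K S (gs a) then S else best K S (gs a))
      [::] l1) <= 1 + size l1 * sz (gs a).
    elim/last_ind: l1 {l2 e} => [|l x IH] //=.
    rewrite -cats1 foldl_cat size_cat addn1 mulSn /=.
    case: ifP => _; first by move: IH; lia.
    by apply: leq_trans (sz_best _ _ _) _; move: IH; lia.
  apply: leq_trans h _.
  rewrite leq_add2l leq_mul2r; apply/orP; right.
  by apply: leq_trans (ltnW (size_sz _)); rewrite e size_cat leq_addr.
- pt_auto.
- cbv beta; apply: pt_if; [| |apply: pt_best]; pt_auto.
  by apply: pt_ncovered; pt_auto.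
- exact: (pb_add (pb_const _ 1) (pb_mul (pt_sz hg) (pt_sz hg))).
Qed.

Lemma pt_lit A `{Enc A} (mu : A -> nat) (s : A -> system) i :
  pt mu s -> pt mu i -> pt mu (fun a => lit (s a) (i a)).
Proof. by move=> hs hi; apply: pt_nth; pt_auto. Qed.

Ltac pt_alg2 := match goal with
  | |- pt _ (fun a => lit (@?s a) (@?i a)) => apply: pt_lit
  | |- pt _ (fun a => fixed _ (@?g a)) => apply: pt_fixed
  end.
Ltac pt_lib ::= first [pt_arith2 | pt_alg2].

Lemma pt_merge A `{Enc A} (mu : A -> nat) p q c s :
  pt mu p -> pt mu q -> pt mu c -> pt mu s ->
  pt mu (fun a => merge (p a) (q a) (c a) (s a)).
Proof. by move=> *; rewrite /merge; pt_auto. Qed.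

Lemma pt_impose A `{Enc A} (mu : A -> nat) u v c (s : A -> system) :
  pt mu u -> pt mu v -> pt mu c -> pt mu s ->
  pt mu (fun a => impose (u a) (v a) (c a) (s a)).
Proof.
move=> hu hv hc hs; rewrite /impose.
apply: pt_if; [|apply: pt_if|]; pt_auto.
by apply: pt_merge; pt_auto.
Qed.

Lemma pt_const_val A `{Enc A} (mu : A -> nat) (s : A -> system) i :
  pt mu s -> pt mu i -> pt mu (fun a => const_val (s a) (i a)).
Proof. by move=> hs hi; rewrite /const_val; pt_auto. Qed.

Lemma pt_free_wire K A `{Enc A} (mu : A -> nat) (g : A -> rgate) j :
  pt mu g -> pt mu (fun a => free_wire K (g a) j).
Proof. by move=> hg; rewrite /free_wire; pt_auto. Qed.

Lemma pt_output K A `{Enc A} (mu : A -> nat) (g : A -> rgate) (s : A -> system) ab :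
  pt mu g -> pt mu s -> pt mu ab -> pt mu (fun a => output K (g a) (s a) (ab a)).
Proof.
move=> hg hs hab; rewrite /output; apply: pt_lookup; first by pt_auto.
apply: pt_cat; last by pt_auto.
apply: pt_map; first exact: pt_fixed.
by apply: pt_const_val; pt_auto.
Qed.

Ltac pt_alg := first [ pt_arith2 | pt_alg2 | match goal with
  | |- pt _ (fun a => impose (@?u a) (@?v a) (@?c a) (@?s a)) => apply: pt_impose
  | |- pt _ (fun a => const_val (@?s a) (@?i a)) => apply: pt_const_val
  | |- pt _ (fun a => free_wire _ (@?g a) _) => apply: pt_free_wire
  | |- pt _ (fun a => output _ (@?g a) (@?s a) (@?i a)) => apply: pt_output
  end ].
Ltac pt_lib ::= pt_alg.

Lemma pt_candidates K A `{Enc A} (mu : A -> nat) y (g : A -> rgate) (s : A -> system) :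
  pt mu y -> pt mu g -> pt mu s -> pt mu (fun a => candidates K (y a) (g a) (s a)).
Proof.
move=> hy hg hs; apply: pt_filter; first exact: pt_const.
by pt_auto.
Qed.

Lemma pt_next K A `{Enc A} (mu : A -> nat) y (g : A -> rgate) (s : A -> system) :
  pt mu y -> pt mu g -> pt mu s -> pt mu (fun a => next K (y a) (g a) (s a)).
Proof.
move=> hy hg hs; have hc := pt_candidates K hy hg hs; rewrite /next.
have hl : pt mu (fun a => lit (s a) 0) by pt_auto.
by pt_auto.
Qed.

(** * Sizes of systems and time of the whole run *)

Definition bounded n (s : system) :=
  [&& s.1 <= n.+1, size s.2 == n.+1 & all (fun l => l.1 <= n) s.2].

Lemma bounded_lit n s i : bounded n s -> (lit s i).1 <= n.
Proof.
case/and3P=> _ _ h; rewrite /lit; case: (ltnP i (size s.2)) => hi.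
  exact: (allP h) (mem_nth _ hi).
by rewrite nth_default.
Qed.

Lemma bounded_impose n u v c s : bounded n s -> all (bounded n) (impose u v c s).
Proof.
move=> hs; rewrite /impose; case: ifP => _; first by case: ifP => //= _; rewrite hs.
rewrite /= andbT /bounded /= size_map; case/and3P: (hs) => h1 -> h3.
apply/and3P; split => //; first by apply: leq_trans h1; apply: leq_pred.
rewrite all_map; apply/allP => l hl /=; case: ifP => _ /=.
  exact: bounded_lit.
exact: (allP h3).
Qed.

Lemma bounded_next n K y g s : bounded n s -> all (bounded n) (next K y g s).
Proof.
move=> hs; rewrite /next; do 4 (case: ifP => _ //; try exact: bounded_impose).
by rewrite /= hs.
Qed.

Lemma bounded_unconstrained n : bounded n (unconstrained n).
Proof.
rewrite /bounded size_map size_iota eqxx leqnn andTb andTb.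
by apply/allP => _ /mapP[i hi ->]; rewrite mem_iota in hi.
Qed.

Lemma size_impose u v c s : size (impose u v c s) <= 1.
Proof. by rewrite /impose; case: ifP => _ //; case: ifP. Qed.

Lemma size_next K y g s : size (next K y g s) <= 1.
Proof.
by rewrite /next; do 4 (case: ifP => _ //; try exact: size_impose).
Qed.

Lemma size_flatten_le T U (f : T -> seq U) s c :
  (forall x, size (f x) <= c) -> size (flatten (map f s)) <= c * size s.
Proof.
move=> h; elim: s => [|x s IH] //=; rewrite size_cat mulnS.
by have := h x; lia.
Qed.

Lemma size_branch n S : size (branch n S) <= 2 ^ size S.
Proof.
elim/last_ind: S => [|S v IH] //; rewrite /branch -cats1 foldl_cat size_cat.
rewrite addn1 expnS.
apply: leq_trans (size_flatten_le (c := 2) _ _) _; last by rewrite leq_mul2l IH.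
move=> s; rewrite size_cat.
have := size_impose v.+1 0 false s; have := size_impose v.+1 0 true s; lia.
Qed.

Lemma all_flatten_map T U (p : pred U) (q : pred T) (f : T -> seq U) s :
  (forall x, q x -> all p (f x)) -> all q s -> all p (flatten (map f s)).
Proof.
move=> h; elim: s => //= x s IH /andP[hx hs].
by rewrite all_cat h // IH.
Qed.

Lemma bounded_branch n S : all (bounded n) (branch n S).
Proof.
elim/last_ind: S => [|S v IH]; first by rewrite /= bounded_unconstrained.
rewrite /branch -cats1 foldl_cat; apply: all_flatten_map IH => s hs.
by rewrite all_cat !bounded_impose.
Qed.

Definition system_sz n := n.+1 * (2 * n + 6) + (2 * n + 5).

Lemma sz_bounded n s : bounded n s -> sz s <= system_sz n.
Proof.
case: s => f l /and3P /= [h1 /eqP h2 h3]; rewrite sz_pair sz_nat /system_sz -h2 sz_sum.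
have : \sum_(x <- l) (sz x).+1 <= size l * (2 * n + 6); last by lia.
elim: l h3 {h2} => [|[r b] l IH] /=; first by rewrite big_nil.
case/andP=> hr /IH h; rewrite big_cons mulSn sz_pair sz_nat.
by move: h; set a := size l * _; set c := \sum_(_ <- _) _; have := sz_bool b; lia.
Qed.

Lemma sz_systems n ss N : all (bounded n) ss -> size ss <= N ->
  sz ss <= (N * (system_sz n).+1).+1.
Proof.
move=> h hN; apply: (leq_trans (n := (size ss * (system_sz n).+1).+1)); last first.
  by rewrite ltnS leq_mul2r hN orbT.
rewrite sz_sum ltnS; elim: ss h {hN} => [|s ss IH] /=; first by rewrite big_nil.
case/andP=> /sz_bounded hs /IH h; rewrite big_cons mulSn.
by move: h; set a := size ss * _; set c := \sum_(_ <- _) _; lia.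
Qed.

Lemma pb_system_sz A (b f : A -> nat) : pb b f -> pb b (fun a => system_sz (f a)).
Proof. by move=> h; rewrite /system_sz; pb_auto. Qed.

(** The only exponential growth: each branched input can double the number of systems. The last
    hypothesis charges this to [mu]. *)
Lemma pt_branch A `{Enc A} (mu : A -> nat) n S :
  pt mu n -> pt mu S -> pb (base mu) (fun a => 2 ^ size (S a)) ->
  pt mu (fun a => branch (n a) (S a)).
Proof.
move=> hn hS hb.
apply: (pt_foldl (G := fun a => (2 ^ size (S a) * (system_sz (n a)).+1).+1)) => //.
- by rewrite /unconstrained; pt_auto.
- by pt_auto.
- by apply: pb_S; apply: pb_mul => //; apply: pb_S; apply: pb_system_sz (pb_nat hn).
- move=> a l1 l2 e /=; rewrite -/(branch (n a) l1); apply: sz_systems.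
    exact: bounded_branch.
  apply: leq_trans (size_branch _ _) _.
  by rewrite leq_exp2l // e size_cat leq_addr.
Qed.

(** Half of a carry plus a count, both at most the length of the list, stays below that length. So
    the carries remain small in unary although the sums compared are exponential. *)
Lemma phi_run_le N e0 e1 :
  [/\ (phi_run N e0 e1).1.1 <= size e0 & (phi_run N e0 e1).1.2 <= size e1].
Proof.
elim: N => [//|N [h0 h1]].
rewrite /phi_run -addn1 iotaD foldl_cat -/(phi_run N e0 e1) /=.
have le a b c : a <= c -> b <= c -> (a + b)./2 <= c by lia.
by rewrite add0n; split; apply: le => //; apply: count_size.
Qed.

Lemma pt_phi_run A `{Enc A} (mu : A -> nat) N e0 e1 :
  pt mu N -> pt mu e0 -> pt mu e1 ->
  pt mu (fun a => phi_run (N a) (e0 a) (e1 a)).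
Proof.
move=> hN h0 h1.
apply: (pt_foldl (G := fun a => 2 * sz (e0 a) + 2 * sz (e1 a) + 7)) => //.
- by pt_auto.
- by pt_auto.
- by rewrite /phi_step; pt_auto.
- by pb_auto; apply: pt_sz.
- move=> a l1 l2 e /=.
  have -> : l1 = iota 0 (size l1).
    have := congr1 (take (size l1)) e; rewrite take_size_cat // => <-.
    have hs : size l1 <= N a.
      by have := congr1 size e; rewrite size_iota size_cat => ->; apply: leq_addr.
    rewrite take_iota size_iota; congr iota; lia.
  have [] := phi_run_le (size l1) (e0 a) (e1 a); rewrite /phi_run.
  case: (foldl _ _ _) => [[r0 r1] acc] /= l0 l3.
  rewrite !sz_pair !sz_nat.
  have h2 := sz_bool acc.
  have h3 : r0 <= sz (e0 a).
    by apply: leq_trans l0 (ltnW (size_sz _)).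
  have h4 : r1 <= sz (e1 a).
    by apply: leq_trans l3 (ltnW (size_sz _)).
  by lia.
Qed.

Lemma pt_phi_leq A `{Enc A} (mu : A -> nat) N e0 e1 :
  pt mu N -> pt mu e0 -> pt mu e1 ->
  pt mu (fun a => phi_leq (N a) (e0 a) (e1 a)).
Proof.
by move=> hN h0 h1; have h := pt_phi_run hN h0 h1; rewrite /phi_leq; pt_auto.
Qed.

Lemma pt_nexts K A `{Enc A} (mu : A -> nat) y (g : A -> rgate) (ss : A -> seq system) :
  pt mu y -> pt mu g -> pt mu ss -> pt mu (fun a => nexts K (y a) (g a) (ss a)).
Proof. by move=> *; apply: pt_flatten; apply: pt_map => //; apply: pt_next; pt_auto. Qed.

Lemma pt_choose K A `{Enc A} (mu : A -> nat) n S r (g : A -> rgate) :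
  pt mu n -> pt mu S -> pt mu r -> pt mu g ->
  pt mu (fun a => choose K (n a) (S a) (r a) (g a)).
Proof.
move=> hn hS hr hg.
have hs y : pt mu (fun a => nexts K y (g a) (r a).2) by apply: pt_nexts; pt_auto.
rewrite /choose; apply: pt_if; [exact: pt_covered|apply: pt_if|by pt_auto].
- by apply: pt_phi_leq; [by pt_auto|apply: pt_map; [exact: hs|by pt_auto]..].
- by pt_auto.
- by pt_auto.
Qed.

Lemma size_nexts K y g ss : size (nexts K y g ss) <= size ss.
Proof. by rewrite -[leqRHS]mul1n; apply: size_flatten_le => s; apply: size_next. Qed.

Lemma bounded_nexts n K y g ss :
  all (bounded n) ss -> all (bounded n) (nexts K y g ss).
Proof. by apply: all_flatten_map => s; apply: bounded_next. Qed.

Lemma run_rcons K n S gs g : run K n S (rcons gs g) = choose K n S (run K n S gs) g.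
Proof. by rewrite /run foldl_rcons. Qed.

Lemma run_bounds K n S gs :
  [/\ size (run K n S gs).1 = size gs, size (run K n S gs).2 <= 2 ^ size S
    & all (bounded n) (run K n S gs).2].
Proof.
elim/last_ind: gs => [|gs g [h1 h2 h3]].
  by split; [|apply: size_branch|apply: bounded_branch].
have hsz y : size (nexts K y g (run K n S gs).2) <= 2 ^ size S.
  exact: leq_trans (size_nexts _ _ _ _) h2.
have hbd y : all (bounded n) (nexts K y g (run K n S gs).2) by apply: bounded_nexts.
by rewrite run_rcons size_rcons /choose; case: ifP => _; [case: ifP => _|];
  rewrite /= h1.
Qed.

Lemma pt_run K A `{Enc A} (mu : A -> nat) n S (gs : A -> seq rgate) :
  pt mu n -> pt mu S -> pt mu gs -> pb (base mu) (fun a => 2 ^ size (S a)) ->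
  pt mu (fun a => run K (n a) (S a) (gs a)).
Proof.
move=> hn hS hg hb; apply: (pt_foldl (G := fun a =>
  (4 * sz (gs a) + 1 + (2 ^ size (S a) * (system_sz (n a)).+1).+1).+1)) => //.
- by apply: pt_pair; [pt_auto | apply: pt_branch].
- by apply: pt_choose; pt_auto.
- apply: pb_S; apply: pb_add; first by pb_auto; apply: pt_sz.
  by apply: pb_S; apply: pb_mul => //; apply: pb_S; apply: pb_system_sz (pb_nat hn).
- move=> a l1 l2 e /=; rewrite -/(run K (n a) (S a) l1).
  have [h1 h2 h3] := run_bounds K (n a) (S a) l1.
  have := sz_systems h3 h2; have := sz_bits (run K (n a) (S a) l1).1.
  rewrite h1; case: (run _ _ _ _) => ys ss /=; rewrite sz_pair.
  have : size l1 <= sz (gs a).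
    by apply: leq_trans (ltnW (size_sz _)); rewrite e size_cat leq_addr.
  by move: (2 ^ _ * _); lia.
Qed.

(** The number of branches is kept as a parameter here; it is estimated only from [greedy_spec]. *)
Lemma pt_solve K :
  pt (fun C : nat * seq rgate => 2 ^ size (greedy K C.1 C.2))
     (fun C => solve K C.1 C.2).
Proof.
apply: pt_rev; apply: pt_fst; apply: pt_run; [pt_auto | | pt_auto | exact: pb_mu].
by apply: pt_greedy; pt_auto.
Qed.

(** * Correctness *)

Definition pot (e : seq nat) := \sum_(i <- e) 2 ^ i.
Definition low N (e : seq nat) := \sum_(i <- e | i < N) 2 ^ i.

Lemma lowS N e : low N.+1 e = low N e + 2 ^ N * count (fun i => i == N) e.
Proof.
rewrite /low; elim: e => [|i e IH]; first by rewrite !big_nil muln0.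
rewrite !big_cons IH /= ltnS leq_eqVlt; case: eqP => [->|_].
  by rewrite ltnn /= add1n mulnS; lia.
by rewrite /= add0n; case: ifP => _; lia.
Qed.

Lemma phi_runS N e0 e1 : phi_run N.+1 e0 e1 = phi_step e0 e1 (phi_run N e0 e1) N.
Proof. by rewrite /phi_run -addn1 iotaD foldl_cat. Qed.

Lemma phi_run_spec N e0 e1 : exists l0 l1,
  [/\ l0 < 2 ^ N, l1 < 2 ^ N, low N e0 = l0 + 2 ^ N * (phi_run N e0 e1).1.1,
      low N e1 = l1 + 2 ^ N * (phi_run N e0 e1).1.2
    & (phi_run N e0 e1).2 = (l0 <= l1)].
Proof.
elim: N => [|N [l0 [l1 [h0 h1 e0E e1E acc]]]].
  by exists 0, 0; split; rewrite ?muln0 // /low big_pred0.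
rewrite phi_runS !lowS e0E e1E /phi_step /=; move: acc.
move: (count _ e0) (count _ e1) (phi_run N e0 e1) {e0E e1E} => c0 c1 [[r0 r1] acc] /= ->.
have split_half a b : 2 ^ N * a + 2 ^ N * b
    = odd (a + b) * 2 ^ N + 2 ^ N.+1 * (a + b)./2.
  by rewrite -mulnDr -{1}[a + b]odd_double_half mulnDr expnS -mul2n; lia.
exists (l0 + odd (r0 + c0) * 2 ^ N), (l1 + odd (r1 + c1) * 2 ^ N).
rewrite -!addnA !split_half !addnA expnS; split => //.
- by case: (odd (r0 + c0)); lia.
- by case: (odd (r1 + c1)); lia.
- by case: (odd (r0 + c0)); case: (odd (r1 + c1)); rewrite /=; lia.
Qed.

(** No exponent reaches [N], so the carries are the complete high parts; they decide, and the low
    digits break a tie. *)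
Lemma phi_leqE N e0 e1 : all (fun i => i < N) e0 -> all (fun i => i < N) e1 ->
  phi_leq N e0 e1 = (pot e0 <= pot e1).
Proof.
have lowE e : all (fun i => i < N) e -> pot e = low N e.
  by move=> h; rewrite /low -big_filter (all_filterP h).
move=> /lowE -> /lowE ->; have [l0 [l1 [h0 h1 -> -> acc]]] := phi_run_spec N e0 e1.
rewrite /phi_leq acc; move: (phi_run N e0 e1) => [[r0 r1] b] /=.
case: eqP => [->|ne]; first by rewrite leq_add2r.
have [lt|ge] := ltnP r0 r1.
  have := leq_mul (leqnn (2 ^ N)) lt; rewrite mulnS (ltnW lt) => h.
  by apply/esym; lia.
have lt : r1 < r0 by lia.
have := leq_mul (leqnn (2 ^ N)) lt; rewrite mulnS => h; rewrite leqNgt lt.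
by apply/esym/negbTE; lia.
Qed.

(** With two distinct classes [s.1] is then at least 2, so [s.1.-1] is a true predecessor and a
    merge halves [2 ^ s.1] exactly; and every surviving system has weight at least 2. *)
Definition good n s := bounded n s && (size (undup [seq l.1 | l <- s.2]) <= s.1).

Lemma good_bounded n s : good n s -> bounded n s.
Proof. by case/andP. Qed.

Lemma size_system n s : bounded n s -> size s.2 = n.+1.
Proof. by case/and3P=> _ /eqP. Qed.

Lemma lit_mem n s i : bounded n s -> i <= n -> lit s i \in s.2.
Proof. by move=> /size_system h hi; apply: mem_nth; rewrite h. Qed.

Lemma good_pos n s : good n s -> 0 < s.1.
Proof.
case/andP=> hb; apply: leq_trans.
have : (lit s 0).1 \in undup [seq l.1 | l <- s.2].
  by rewrite mem_undup map_f // (lit_mem hb).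
by case: (undup _).
Qed.

Lemma merge_shrinks n u v c s : good n s -> u <= n -> v <= n ->
  (lit s u).1 != (lit s v).1 ->
  good n (merge (lit s u) (lit s v) c s) /\
  2 * 2 ^ (merge (lit s u) (lit s v) c s).1 = 2 ^ s.1.
Proof.
move=> hg hu hv ne; case/andP: (hg) => hb hf.
set p := lit s u in ne *; set q := lit s v in ne *.
set r := [seq l.1 | l <- s.2] in hf *.
have pr : p.1 \in undup r by rewrite mem_undup map_f // (lit_mem hb).
have qr : q.1 \in undup r by rewrite mem_undup map_f // (lit_mem hb).
have f2 : 1 < s.1.
  apply: leq_trans hf; apply: (@uniq_leq_size _ [:: p.1; q.1]).
    by rewrite /= inE ne.
  by move=> z; rewrite !inE => /orP[]/eqP ->.
split; last by rewrite -expnS prednK // ltnW.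
rewrite /good; apply/andP; split.
  have := bounded_impose u v c hb; rewrite /impose (negbTE ne) /=.
  by rewrite andbT.
(* The classes after the merge are among the old ones without [p.1]. *)
apply: (leq_trans (n := size (rem p.1 (undup r)))); last first.
  by rewrite size_rem //=; move: hf; case: (s.1) => [|f]; case: (size _).
apply: uniq_leq_size (undup_uniq _) _ => z; rewrite mem_undup -map_comp.
case/mapP=> l hl -> /=; rewrite mem_rem_uniq ?undup_uniq // inE.
case: ifP => [_|/negbT e] /=; first by rewrite eq_sym ne.
by rewrite e mem_undup map_f.
Qed.

Lemma good_impose n u v c s : good n s -> u <= n -> v <= n ->
  all (good n) (impose u v c s).
Proof.
move=> hg hu hv; rewrite /impose.
case: ifP => [_|/negbT ne]; first by case: ifP => //= _; rewrite hg.
by rewrite /= andbT; case: (merge_shrinks c hg hu hv ne).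
Qed.

Lemma pot1 i : pot [:: i] = 2 ^ i.
Proof. by rewrite /pot big_seq1. Qed.

Lemma pot0 : pot [::] = 0.
Proof. by rewrite /pot big_nil. Qed.

Lemma pot_cons i e : pot (i :: e) = 2 ^ i + pot e.
Proof. by rewrite /pot big_cons. Qed.

Lemma pot_cat e1 e2 : pot (e1 ++ e2) = pot e1 + pot e2.
Proof. by rewrite /pot big_cat. Qed.

Lemma impose_shrinks n u v c s : good n s -> u <= n -> v <= n ->
  (lit s u).1 != (lit s v).1 -> 2 * pot (exponents (impose u v c s)) = 2 ^ s.1.
Proof.
move=> hg hu hv ne; rewrite /impose (negbTE ne) /exponents /= pot1.
by case: (merge_shrinks c hg hu hv ne).
Qed.

Lemma impose_pot n u v c s : good n s -> u <= n -> v <= n ->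
  pot (exponents (impose u v c s)) <= 2 ^ s.1.
Proof.
move=> hg hu hv; have [e|ne] := eqVneq (lit s u).1 (lit s v).1; last first.
  by have := impose_shrinks c hg hu hv ne; lia.
by rewrite /impose e eqxx; case: ifP => _; rewrite ?pot0 // pot1.
Qed.

(** The two values split the solution space: two halves if the equation is independent, the whole
    and nothing if it is already decided. So branching does not raise the total weight. *)
Lemma impose_both n u v s : good n s -> u <= n -> v <= n ->
  pot (exponents (impose u v false s ++ impose u v true s)) <= 2 ^ s.1.
Proof.
move=> hg hu hv; rewrite /exponents map_cat pot_cat.
have [e|ne] := eqVneq (lit s u).1 (lit s v).1; last first.
  have := impose_shrinks true hg hu hv ne; have := impose_shrinks false hg hu hv ne.
  by rewrite /exponents; lia.
by rewrite /impose e eqxx; case: (_ (+) _); rewrite /= pot1 pot0 ?addn0.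
Qed.

(** The cases in which [next] loses at least half of the weight. The flags tell which of the three
    left-hand sides x, y, x + y are already constant. *)
Definition shrinks e1 e2 e3 (L : seq (bool * bool)) :=
  [|| nilp L, ~~ e1 && all (fun ab => ab.1 == (head (false, false) L).1) L,
      ~~ e2 && all (fun ab => ab.2 == (head (false, false) L).2) L
    | ~~ e3 && all (fun ab => ab.1 (+) ab.2 == (head (false, false) L).1 (+)
                    (head (false, false) L).2) L].

(* At most four points are possible, so for one of the two outputs at most half
   of them remain, and any two points of the plane over F_2 form a line. *)
Lemma one_output_shrinks e1 e2 e3 c1 c2 (o : bool * bool -> bool) :
  let L y := [seq ab <- bool_pairs | [&& e1 ==> (ab.1 == c1), e2 ==> (ab.2 == c2),
                e3 ==> (ab.1 (+) ab.2 == c1 (+) c2) & o ab == y]] in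
  shrinks e1 e2 e3 (L false) || shrinks e1 e2 e3 (L true).
Proof.
rewrite /=; move: (o (false, false)) (o (false, true)) (o (true, false)) (o (true, true)).
move: e1 e2 e3 c1 c2.
by do 9 case.
Qed.

Lemma next_pot K n y g s : good n s -> free_wire K g 0 <= n -> free_wire K g 1 <= n ->
  pot (exponents (next K y g s)) <= 2 ^ s.1.
Proof.
move=> hg hu hv; rewrite /next.
by do 4 (case: ifP => _; [by rewrite ?pot0 ?(impose_pot _ hg) | ]); rewrite pot1.
Qed.

Lemma next_shrinks K n y g s :
  good n s -> free_wire K g 0 <= n -> free_wire K g 1 <= n ->
  shrinks ((lit s (free_wire K g 0)).1 == (lit s 0).1)
    ((lit s (free_wire K g 1)).1 == (lit s 0).1)
    ((lit s (free_wire K g 0)).1 == (lit s (free_wire K g 1)).1)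
    (candidates K y g s) -> 2 * pot (exponents (next K y g s)) <= 2 ^ s.1.
Proof.
move=> hg hu hv; rewrite /shrinks /next.
case: nilp => /=; first by rewrite pot0.
case: ifP => [/andP[h _] _|_ /=]; first by rewrite (impose_shrinks _ hg).
case: ifP => [/andP[h _] _|_ /=]; first by rewrite (impose_shrinks _ hg).
case: ifP => [/andP[h _] _|_ /=] //; by rewrite (impose_shrinks _ hg).
Qed.

(** One output halves the weight and the other does not raise it: 1 + 1/2 = 3/2. A bound on the sum,
    unlike one on the better output, can be added up over branches that prefer different outputs. *)
Lemma next_sum K n g s : good n s -> free_wire K g 0 <= n -> free_wire K g 1 <= n ->
  2 * (pot (exponents (next K false g s)) + pot (exponents (next K true g s)))
    <= 3 * 2 ^ s.1.
Proof.
move=> hg hu hv.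
have h y : pot (exponents (next K y g s)) <= 2 ^ s.1 by apply: next_pot hg hu hv.
have := h true; have := h false.
have := one_output_shrinks ((lit s (free_wire K g 0)).1 == (lit s 0).1)
  ((lit s (free_wire K g 1)).1 == (lit s 0).1)
  ((lit s (free_wire K g 0)).1 == (lit s (free_wire K g 1)).1)
  (const_val s (free_wire K g 0)) (const_val s (free_wire K g 1)) (output K g s).
(* The offset of unknown 0 cancels, which matches the third test in [candidates]. *)
have -> : const_val s (free_wire K g 0) (+) const_val s (free_wire K g 1) =
    (lit s (free_wire K g 0)).2 (+) (lit s (free_wire K g 1)).2.
  by rewrite /const_val addbACA addbb addbF.
by case/orP=> /(next_shrinks hg hu hv); lia.
Qed.

Lemma good_next K n y g s : good n s -> free_wire K g 0 <= n -> free_wire K g 1 <= n ->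
  all (good n) (next K y g s).
Proof.
move=> hg hu hv; rewrite /next.
by do 4 (case: ifP => _; [by rewrite ?(good_impose _ hg) | ]); rewrite /= hg.
Qed.

Definition unknown (x : seq bool) i := nth false (false :: x) i.
(** The case [i = 0] forces the class variable of unknown 0 to equal its offset, which gives
    [const_val] its meaning. *)
Definition sat n x s := exists X : nat -> bool,
  forall i, i <= n -> unknown x i = X (lit s i).1 (+) (lit s i).2.

Lemma lit_merge n p q c s i : bounded n s -> i <= n ->
  lit (merge p q c s) i = if (lit s i).1 == p.1
    then (q.1, (lit s i).2 (+) (p.2 (+) q.2 (+) c)) else lit s i.
Proof.
move=> /size_system hs hi.
by rewrite /lit /merge (nth_map (0, false)) ?hs.
Qed.

Lemma impose_same_class n u v c s s' i j : bounded n s -> i <= n -> j <= n ->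
  s' \in impose u v c s -> (lit s i).1 == (lit s j).1 -> (lit s' i).1 == (lit s' j).1.
Proof.
move=> hb hi hj; rewrite /impose.
case: ifP => _; first by case: ifP => // _; rewrite inE => /eqP ->.
rewrite inE => /eqP -> /eqP e; rewrite !(lit_merge _ _ _ hb) // e.
by case: ifP => _ //=; rewrite e.
Qed.

Lemma impose_joins n u v c s s' : bounded n s -> u <= n -> v <= n ->
  s' \in impose u v c s -> (lit s' u).1 == (lit s' v).1.
Proof.
move=> hb hu hv; rewrite /impose.
case: ifP => [e|ne]; first by case: ifP => // _; rewrite inE => /eqP ->.
rewrite inE => /eqP ->; rewrite !(lit_merge _ _ _ hb) // eqxx [_ == (lit s u).1]eq_sym ne.
exact: eqxx.
Qed.

Lemma impose_sound n x u v s : bounded n s -> u <= n -> v <= n -> sat n x s ->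
  exists2 s', s' \in impose u v (unknown x u (+) unknown x v) s & sat n x s'.
Proof.
move=> hb hu hv [X hX]; rewrite /impose.
case: eqP => [e|/eqP ne].
  exists s; last by exists X.
  by rewrite !hX // e addbACA addbb addFb eqxx mem_head.
eexists; first exact: mem_head.
(* The same [X] works: the value of the eliminated class variable is no longer consulted. *)
exists X => i hi; rewrite (lit_merge _ _ _ hb hi) !hX //.
case: eqP => [->|_] //=.
move: (X _) (X _) (_.2) (_.2) (_.2) => b1 b2 b3 b4 b5.
by case: b1; case: b2; case: b3; case: b4; case: b5.
Qed.

Definition anchored S s := all (fun v => (lit s v.+1).1 == (lit s 0).1) S.

Lemma anchored_impose n S u v c s s' : bounded n s -> all (fun v => v < n) S ->
  s' \in impose u v c s -> anchored S s -> anchored S s'.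
Proof.
move=> hb hS hs' /allP h; apply/allP => w hw.
by apply: (impose_same_class hb _ _ hs' (h w hw)) => //; apply: (allP hS).
Qed.

Lemma branch_rcons n S v : branch n (rcons S v) =
  flatten [seq impose v.+1 0 false s ++ impose v.+1 0 true s | s <- branch n S].
Proof. by rewrite /branch foldl_rcons. Qed.

Lemma lit_unconstrained n i : i <= n -> lit (unconstrained n) i = (i, false).
Proof.
by move=> hi; rewrite /lit (nth_map 0) ?size_iota // nth_iota.
Qed.

Lemma good_unconstrained n : good n (unconstrained n).
Proof.
have e : [seq l.1 | l <- (unconstrained n).2] = iota 0 n.+1.
  by rewrite -map_comp map_id_in.
rewrite /good bounded_unconstrained e undup_id ?iota_uniq ?size_iota //.
exact: leqnn.
Qed.

Lemma pot_flatten_map (f : system -> seq system) ss a b :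
  (forall s, s \in ss -> b * pot (exponents (f s)) <= a * 2 ^ s.1) ->
  b * pot (exponents (flatten (map f ss))) <= a * pot (exponents ss).
Proof.
elim: ss => [|s ss IH] h; first by rewrite /= pot0 muln0.
rewrite /= /exponents map_cat pot_cat /= pot_cons !mulnDr leq_add ?h ?mem_head //.
by apply: IH => t ht; apply: h; rewrite inE ht orbT.
Qed.

Lemma branch_spec n S x : all (fun v => v < n) S ->
  [/\ all (good n) (branch n S), all (anchored S) (branch n S),
      pot (exponents (branch n S)) <= 2 ^ n.+1 &
      exists2 s, s \in branch n S & sat n x s].
Proof.
elim/last_ind: S => [_|S v IH].
  split; rewrite /= ?andbT ?good_unconstrained //; first by rewrite /exponents /= pot1.
  exists (unconstrained n); first exact: mem_head.
  by exists (unknown x) => i hi; rewrite lit_unconstrained // addbF.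
rewrite all_rcons => /andP[hv hS]; have [hg ha hp [s hs hx]] := IH hS.
have hb t : t \in branch n S -> bounded n t by move/(allP hg)/good_bounded.
rewrite branch_rcons; split.
- apply/allP => t /flatten_mapP[t' ht']; have g' := allP hg _ ht'.
  by rewrite mem_cat => /orP[]; apply/allP; apply: good_impose.
- apply/allP => t /flatten_mapP[t' ht'].
  have {}h c : t \in impose v.+1 0 c t' -> anchored (rcons S v) t.
    move=> h; rewrite /anchored all_rcons (impose_joins (hb _ ht') _ _ h) //.
    exact: anchored_impose (hb _ ht') hS h (allP ha _ ht').
  by rewrite mem_cat => /orP[]; apply: h.
- apply: leq_trans hp.
  rewrite -[leqLHS]mul1n -[leqRHS]mul1n; apply: pot_flatten_map => t ht.
  by rewrite !mul1n; apply: impose_both (allP hg _ ht) _ _.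
- have [t ht htx] := impose_sound (u := v.+1) (v := 0) (hb _ hs) hv (leq0n n) hx.
  exists t => //; apply/flatten_mapP; exists s => //; rewrite mem_cat.
  by move: ht; case: (_ (+) _) => ->; rewrite ?orbT.
Qed.

Definition raw_eval (g : rgate) x :=
  nth false g.2 (bits_val [seq nth false x i | i <- g.1]).
Definition wf_gate K n (g : rgate) := (size g.1 <= K + 2) && all (fun i => i < n) g.1.

Lemma free_wire_le K n g j : wf_gate K n g -> free_wire K g j <= n.
Proof.
case/andP=> _ h; rewrite /free_wire.
have [lt|ge] := ltnP j (size (drop K g.1)); last by rewrite nth_default ?size_map.
rewrite (nth_map 0) //; apply: (allP h); apply: mem_drop; exact: mem_nth lt.
Qed.

Lemma const_valE n x s i : sat n x s -> i <= n -> (lit s i).1 == (lit s 0).1 ->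
  const_val s i = unknown x i.
Proof.
move=> [X hX] hi /eqP e; have := hX 0 (leq0n n); rewrite (hX i hi) e /const_val {1}/unknown /=.
by case: (X _); case: (lit s i).2; case: (lit s 0).2.
Qed.

Lemma output_sound K n x g s : wf_gate K n g -> anchored (fixed K g) s -> sat n x s ->
  output K g s (unknown x (free_wire K g 0), unknown x (free_wire K g 1)) =
  raw_eval g x.
Proof.
move=> /andP[sz_g /allP lt_g] /allP ha hx; rewrite /output /raw_eval; congr nth.
rewrite -[in RHS](cat_take_drop K g.1) map_cat /bits_val !foldr_cat.
congr foldr.
  (* A missing wire contributes a trailing [false], a leading zero of the index, which leaves
     [bits_val] unchanged. *)
  have : size (drop K g.1) <= 2 by rewrite size_drop; lia.
  by rewrite /free_wire; case: (drop K g.1) => [|i [|j [|]]].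
apply/eq_in_map => i hi; rewrite (const_valE hx) ?ha //.
exact: (lt_g _ (mem_take hi)).
Qed.

(** The true values of the two free wires form a candidate, so any equation shared by all candidates
    holds for [x]. *)
Lemma next_sound K n x g s : bounded n s -> wf_gate K n g ->
  anchored (fixed K g) s -> sat n x s ->
  exists2 s', s' \in next K (raw_eval g x) g s & sat n x s'.
Proof.
move=> hb hg ha hx; have hu := free_wire_le 0 hg; have hv := free_wire_le 1 hg.
set u := free_wire K g 0 in hu *; set v := free_wire K g 1 in hv *.
set L := candidates K (raw_eval g x) g s.
have inL : (unknown x u, unknown x v) \in L.
  rewrite mem_filter -!/u -!/v /= (output_sound hg) // eqxx andbT.
  apply/andP; split; last first.
    by case: (unknown x u); case: (unknown x v).
  apply/and3P; split; apply/implyP => e.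
  - by rewrite (const_valE hx).
  - by rewrite (const_valE hx).
  - by case: hx => X hX; rewrite !hX // (eqP e) addbACA addbb.
have val0 : unknown x 0 = false by [].
rewrite /next -/L -/u -/v.
case: ifP => [|_]; first by move: inL; case: (L).
case: ifP => [/andP[_ /allP/(_ _ inL)/eqP /= <-]|_].
  by have := impose_sound hb hu (leq0n n) hx; rewrite val0 addbF.
case: ifP => [/andP[_ /allP/(_ _ inL)/eqP /= <-]|_].
  by have := impose_sound hb hv (leq0n n) hx; rewrite val0 addbF.
case: ifP => [/andP[_ /allP/(_ _ inL)/eqP /= <-]|_].
  exact: impose_sound.
by exists s; rewrite ?mem_head.
Qed.

Lemma anchored_next K n S y g s s' : bounded n s -> all (fun v => v < n) S ->
  s' \in next K y g s -> anchored S s -> anchored S s'.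
Proof.
move=> hb hS; rewrite /next.
case: ifP => _ //; do 3 (case: ifP => _; first exact: anchored_impose hb hS).
by rewrite inE => /eqP ->.
Qed.

Lemma nexts_sum K n g ss : all (good n) ss -> wf_gate K n g ->
  2 * (pot (exponents (nexts K false g ss)) + pot (exponents (nexts K true g ss)))
    <= 3 * pot (exponents ss).
Proof.
move=> + hg; elim: ss => [|s ss IH]; first by rewrite /nexts /= pot0.
case/andP=> hs /IH; have := next_sum hs (free_wire_le 0 hg) (free_wire_le 1 hg).
have nexts_cons y : pot (exponents (nexts K y g (s :: ss))) =
    pot (exponents (next K y g s)) + pot (exponents (nexts K y g ss)).
  by rewrite -pot_cat -map_cat.
have arith a b a0 b0 a1 b1 p q : a = a0 + a1 -> b = b0 + b1 ->
    2 * (a0 + b0) <= 3 * p -> 2 * (a1 + b1) <= 3 * q -> 2 * (a + b) <= 3 * (p + q).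
  by lia.
by move=> h1 h2; rewrite pot_cons; apply: arith h1 h2; apply: nexts_cons.
Qed.

(** One step of the invariant below: [P] and [Q] are powers of 4 and 3, [p] is the old potential,
    [r] the sum over both outputs and [q] the potential for the chosen one. *)
Lemma half_pot_arith P Q N p q r : P * p <= Q * N -> 2 * r <= 3 * p -> 2 * q <= r ->
  4 * P * q <= 3 * Q * N.
Proof.
move=> h h1 h2; have le : 4 * q <= 3 * p by lia.
by have := leq_mul (leqnn P) le; lia.
Qed.

(** The third clause bounds the potential by (3/4)^c 2^(n+1), denominators cleared, with c the
    number of covered gates seen. By the fourth, an input producing exactly the chosen bits survives
    in some branch. *)
Lemma run_spec K n S gs x : all (wf_gate K n) gs -> all (fun v => v < n) S ->
  [/\ all (good n) (run K n S gs).2, all (anchored S) (run K n S gs).2,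
      4 ^ ncovered K S gs * pot (exponents (run K n S gs).2)
        <= 3 ^ ncovered K S gs * 2 ^ n.+1
    & rev (run K n S gs).1 = [seq raw_eval g x | g <- gs] ->
      exists2 s, s \in (run K n S gs).2 & sat n x s].
Proof.
move=> + hS; elim/last_ind: gs => [_|gs g IH].
  by have [h1 h2 h3 h4] := branch_spec x hS; split; rewrite ?mul1n.
rewrite all_rcons run_rcons map_rcons /ncovered -cats1 count_cat /= addn0.
case/andP=> hg /IH [h1 h2 h3 h4].
set r := run K n S gs in h1 h2 h3 h4 *; rewrite /ncovered in h3.
have good_nexts y : all (good n) (nexts K y g r.2).
  apply: all_flatten_map h1 => s hs.
  exact: good_next hs (free_wire_le 0 hg) (free_wire_le 1 hg).
have anch_nexts y : all (anchored S) (nexts K y g r.2).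
  apply/allP => t /flatten_mapP[s hs ht].
  exact: anchored_next (good_bounded (allP h1 _ hs)) hS ht (allP h2 _ hs).
have small y : all (fun i => i < n.+2) (exponents (nexts K y g r.2)).
  apply/allP => _ /mapP[s hs ->]; rewrite ltnS.
  by have /good_bounded/and3P[] := allP (good_nexts y) s hs.
rewrite /choose; case cov: (covered K S g); last first.
  split; rewrite ?addn0 //= rev_cons => /eqP.
  by rewrite eqseq_rcons => /andP[/eqP /h4].
have cov_anch s : anchored S s -> anchored (fixed K g) s.
  move=> /allP ha; apply/allP => i hi; have /hasP[j hj /eqP ->] := allP cov i hi.
  exact: ha.
have sound y : rcons (rev r.1) y = rcons [seq raw_eval g0 x | g0 <- gs] (raw_eval g x) ->
    exists2 s, s \in nexts K y g r.2 & sat n x s.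
  move=> /eqP; rewrite eqseq_rcons => /andP[/eqP /h4[s hs hx] /eqP ->].
  have [t ht htx] := next_sound (good_bounded (allP h1 _ hs)) hg
    (cov_anch _ (allP h2 _ hs)) hx.
  by exists t => //; apply/flatten_mapP; exists s.
have half_pot y : 2 * pot (exponents (nexts K y g r.2)) <=
   pot (exponents (nexts K false g r.2)) + pot (exponents (nexts K true g r.2)) ->
   4 ^ (count (covered K S) gs + 1) * pot (exponents (nexts K y g r.2)) <=
   3 ^ (count (covered K S) gs + 1) * 2 ^ n.+1.
  move=> le; rewrite !addn1 !(expnS _ (count _ _)).
  exact: half_pot_arith h3 (nexts_sum h1 hg) le.
rewrite phi_leqE //; case: leqP => le; split; rewrite //= ?rev_cons //.
- by apply: half_pot; lia.
- exact: sound.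
- by apply: half_pot; lia.
- exact: sound.
Qed.

(** Three covered gates per input suffice because 2 * 3^3 < 4^3, while 2 * 3^2 > 4^2: this is the 3
    in the hypothesis on m. For [n = 0] strictness comes from [0 < c]. *)
Lemma exp_contra n c : 3 * n <= c -> 0 < c -> 3 ^ c * 2 ^ n < 4 ^ c.
Proof.
move=> le c0; have [->|n0] := posnP n; first by rewrite muln1 ltn_exp2r.
have -> : c = 3 * n + (c - 3 * n) by rewrite subnKC.
move: (c - _) => d; rewrite !(expnD _ (3 * n) d) !(expnM _ 3 n) mulnAC -expnMn.
apply: (leq_trans (n := (4 ^ 3) ^ n * 3 ^ d)); last by rewrite leq_mul2l leq_exp2r' ?orbT.
by rewrite ltn_mul2r expn_gt0 /= ltn_exp2r.
Qed.

Lemma run_avoids K n S gs x : all (wf_gate K n) gs -> all (fun v => v < n) S ->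
  3 * n <= ncovered K S gs -> 0 < ncovered K S gs ->
  rev (run K n S gs).1 <> [seq raw_eval g x | g <- gs].
Proof.
move=> hg hS h1 h2 e; have [good_r _ le /(_ e) [s hs _]] := run_spec x hg hS.
have := exp_contra h1 h2.
(* A surviving system keeps the class of unknown 0. This factor 2 matches the initial weight
   [2 ^ n.+1]. *)
have : 2 <= pot (exponents (run K n S gs).2).
  rewrite /pot (big_rem s.1) ?map_f //=.
  have := leq_exp2l 1 s.1 (isT : 1 < 2); rewrite (good_pos (allP good_r _ hs)) => h.
  by apply: leq_trans (leq_addr _ _); rewrite expn1 in h.
move: le; set a := 4 ^ _; set b := 3 ^ _; rewrite expnS.
move=> le h3 lt; have := leq_mul (leqnn a) h3; move: le lt.
by rewrite mulnCA; lia.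
Qed.

(** * Size of the set of branched inputs *)

(** The popular value is given by an element attaining it, because [best] tries only sets
    [fixed K g] with [g] a gate. *)
Lemma pigeonhole (X : eqType) (T : finType) (f : X -> T) (s : seq X) : 0 < size s ->
  exists2 x, x \in s & size s <= #|T| * count (fun y => f y == f x) s.
Proof.
move=> s0.
have sum_count : \sum_(t : T) count (fun y => f y == t) s = size s.
  elim: s {s0} => [|x s IH] /=; first by rewrite big1.
  rewrite big_split /= IH (bigD1 (f x)) //= eqxx big1 ?addn0 // => t ht.
  by rewrite eq_sym (negbTE ht).
have [/existsP[t ht]|/existsPn h] :=
  boolP [exists t : T, size s <= #|T| * count (fun y => f y == t) s].
  have : 0 < count (fun y => f y == t) s.
    by move: (leq_trans s0 ht); rewrite muln_gt0 => /andP[].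
  by rewrite -has_count => /hasP[x hx /eqP e]; exists x; rewrite ?e.
have : \sum_(t : T) (#|T| * count (fun y => f y == t) s).+1 <= \sum_(t : T) size s.
  by apply: leq_sum => t _; rewrite ltnNge.
have sumT c : \sum_(t : T) c = #|T| * c by rewrite -sum_nat_const; apply: eq_bigl.
rewrite sumT (eq_bigr (fun t => 1 + #|T| * count (fun y => f y == t) s)) //.
rewrite big_split /= -big_distrr /= sum_count sumT muln1.
have : 0 < #|T| by case: s s0 {sum_count h} => // x s _; apply/card_gt0P; exists (f x).
by move: (_ * size s) => N; lia.
Qed.

Lemma covered_cat K S S' g : covered K S g -> covered K (S ++ S') g.
Proof. by apply: sub_all => i; rewrite has_cat => ->. Qed.

Lemma covered_mem K S g : covered K S g = all (mem S) (fixed K g).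
Proof.
apply: eq_all => i; apply/hasP/idP => [[j hj /eqP ->]|hi] //.
by exists i.
Qed.

(* Padding [fixed K g] with [n] to length [K]. *)
Definition code K n g : {ffun 'I_K -> 'I_n.+1} :=
  [ffun i : 'I_K => inord (nth n (fixed K g) i)].

Lemma wf_fixed K n g : wf_gate K n g -> all (fun i => i < n) (fixed K g).
Proof. by case/andP=> _ /allP h; apply/allP => i /mem_take; apply: h. Qed.

Lemma code_covered K n S g g' : wf_gate K n g -> wf_gate K n g' ->
  code K n g' = code K n g -> covered K (S ++ fixed K g) g'.
Proof.
move=> /wf_fixed/allP hg /wf_fixed/allP hg' /ffunP e; rewrite covered_mem.
apply/allP => i hi; rewrite inE mem_cat; apply/orP; right.
have hj : index i (fixed K g') < K.
  apply: (leq_trans (n := size (fixed K g'))); first by rewrite index_mem.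
  by rewrite size_take_min geq_minl.
have le_n : nth n (fixed K g) (index i (fixed K g')) < n.+1.
  have [lt|ge] := ltnP (index i (fixed K g')) (size (fixed K g)).
    by apply: leqW; apply: hg; apply: mem_nth.
  by rewrite nth_default.
have := e (Ordinal hj); rewrite !ffunE /= nth_index // => /(congr1 val).
rewrite /= (inordK le_n) inordK ?(leqW (hg' _ hi)) //.
have [lt|ge] := ltnP (index i (fixed K g')) (size (fixed K g)).
  by move=> ->; apply: mem_nth.
(* The padding value [n] is not the index of a wire. *)
by rewrite nth_default // => ei; have := hg' _ hi; rewrite ei ltnn.
Qed.

Lemma best_spec K S gs :
  (best K S gs = S \/ exists2 g, g \in gs & best K S gs = S ++ fixed K g) /\
  (forall g, g \in gs -> ncovered K (S ++ fixed K g) gs <= ncovered K (best K S gs) gs).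
Proof.
rewrite /best; set F := fun _ _ => _.
suff h l : {subset l <= gs} -> (foldl F S l = S \/
    exists2 g, g \in gs & foldl F S l = S ++ fixed K g) /\
  (forall g, g \in l -> ncovered K (S ++ fixed K g) gs <= ncovered K (foldl F S l) gs).
  exact: h.
elim/last_ind: l => [|l g IH] sub; first by split; [left|].
have [|h1 h2] := IH; first by move=> g' hg'; apply: sub; rewrite mem_rcons inE hg' orbT.
rewrite foldl_rcons {1 3 5}/F; case: ifP => lt; split.
- by right; exists g => //; apply: sub; rewrite mem_rcons mem_head.
- move=> g'; rewrite mem_rcons inE => /orP[/eqP -> //|/h2 le].
  exact: leq_trans le (ltnW lt).
- exact: h1.
- move=> g'; rewrite mem_rcons inE => /orP[/eqP ->|/h2 //].
  by rewrite leqNgt lt.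
Qed.

Lemma count_add (T : eqType) (p q r : pred T) s :
  {in s, forall x, p x -> r x} -> {in s, forall x, q x -> r x && ~~ p x} ->
  count p s + count q s <= count r s.
Proof.
elim: s => //= x s IH h1 h2.
have := h1 x (mem_head _ _); have := h2 x (mem_head _ _).
have {}IH : count p s + count q s <= count r s.
  by apply: IH => y hy; [apply: h1|apply: h2]; rewrite inE hy orbT.
by case: (p x); case: (q x); case: (r x) => //= a b; rewrite ?(a isT) ?(b isT);
  try (have := a isT); try (have := b isT); lia.
Qed.

(** Some code is shared by [d] uncovered gates, and all of these become covered at once. There are
    [n.+1 ^ K] codes, at most [2 ^ K * n ^ K] since [n] is positive. *)
Lemma best_gain K n S gs : 0 < K -> 0 < n -> all (wf_gate K n) gs ->
  ncovered K S gs < 3 * n -> 3 * n ^ K <= size gs ->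
  exists d, [/\ 0 < d, ncovered K S gs + d <= ncovered K (best K S gs) gs &
    size gs <= d * (6 * 2 ^ K * n ^ K)].
Proof.
move=> K0 n0 /allP hg lt le.
have le_n : n <= n ^ K by rewrite -{1}[n]expn1 leq_pexp2l.
pose U := [seq g <- gs | ~~ covered K S g].
have sizeU : size U + ncovered K S gs = size gs.
  by rewrite size_filter addnC -(count_predC (covered K S)).
have U0 : 0 < size U by lia.
have [g gU] := pigeonhole (code K n) U0.
move: gU; rewrite mem_filter => /andP[ncov_g g_gs].
rewrite card_ffun !card_ord; set d := count _ _ => le_d.
have d0 : 0 < d by move: (leq_trans U0 le_d); rewrite muln_gt0 => /andP[].
have pow : n.+1 ^ K <= 2 ^ K * n ^ K by rewrite -expnMn leq_exp2r; lia.
exists d; split => //.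
- have [_ /(_ g g_gs) hbest] := best_spec K S gs; apply: leq_trans hbest.
  rewrite /d count_filter; apply: count_add => y y_gs; first exact: covered_cat.
  case/andP=> /eqP e -> /=; rewrite andbT.
  exact: code_covered (hg _ g_gs) (hg _ y_gs) e.
- have {}le_d : size U <= 2 ^ K * n ^ K * d.
    by apply: leq_trans le_d _; rewrite leq_mul2r pow orbT.
  have p0 : 0 < 2 ^ K by rewrite expn_gt0.
  (* The 6 serves the case of fewer than [6 * n] gates. Otherwise at least half of the gates are
     uncovered, and 2 would do. *)
  have [small|big] := ltnP (size gs) (6 * n).
    have := leq_mul p0 (leq_mul d0 le_n); lia.
  lia.
Qed.

(** Here [a] counts the effective rounds. Coverage is known to be below [3 * n] only before the last
    of them, hence [a.-1]; the last round adds at most [K] inputs. *)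
Lemma greedy_spec K n gs : 0 < K -> 0 < size gs -> 3 * n ^ K <= size gs ->
  all (wf_gate K n) gs ->
  [/\ all (fun v => v < n) (greedy K n gs), 3 * n <= ncovered K (greedy K n gs) gs,
      0 < ncovered K (greedy K n gs) gs
    & exists a, size (greedy K n gs) <= K * a /\
        a.-1 * size gs <= 3 * n * (6 * 2 ^ K * n ^ K)].
Proof.
move=> K0 gs0 le hg; set Q := 6 * _ * _.
(* Without inputs no gate has a wire, and the empty set covers all of them. *)
have [n0|n0] := posnP n.
  have -> : greedy K n gs = [::].
    by rewrite /greedy n0; elim: (X in foldl _ _ X) => //=.
  have -> : ncovered K [::] gs = size gs.
    apply/eqP; rewrite -all_count; apply/allP => g /(allP hg)/wf_fixed.
    by rewrite n0 /covered; case: (fixed K g).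
  by split; rewrite ?n0 //; exists 0; rewrite !muln0.
have le_n : n <= n ^ K by rewrite -{1}[n]expn1 leq_pexp2l.
pose F S (_ : rgate) := if n + n + n <= ncovered K S gs then S else best K S gs.
have inv l : [/\ all (fun v => v < n) (foldl F [::] l),
    ncovered K (foldl F [::] l) gs < 3 * n -> size l <= ncovered K (foldl F [::] l) gs &
    exists a, [/\ size (foldl F [::] l) <= K * a, a.-1 * size gs <= 3 * n * Q &
      ncovered K (foldl F [::] l) gs < 3 * n ->
      a * size gs <= ncovered K (foldl F [::] l) gs * Q]].
  elim/last_ind: l => [|l g [h1 h2 [a [h3 h4 h5]]]].
    by split => //; exists 0; split.
  rewrite foldl_rcons; set S := foldl F [::] l in h1 h2 h3 h5 *.
  have : F S g = if n + n + n <= ncovered K S gs then S else best K S gs by [].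
  case: ifP => cov ->.
    split => //; first by move=> h; exfalso; lia.
    by exists a; split => // h; exfalso; lia.
  have lt : ncovered K S gs < 3 * n by lia.
  have [d [d0 gain leQ]] := best_gain K0 n0 hg lt le; rewrite -/Q in leQ.
  have [hbest _] := best_spec K S gs; rewrite size_rcons; split.
  - case: hbest => [->//|[g' hg' ->]]; rewrite all_cat h1.
    exact: wf_fixed (allP hg _ hg').
  - by have := h2 lt; lia.
  - exists a.+1; split.
    + case: hbest => [->|[g' hg' ->]]; first by rewrite mulnS; lia.
      have : size (fixed K g') <= K by rewrite size_take_min geq_minl.
      by rewrite size_cat mulnS; lia.
    + by apply: leq_trans (h5 lt) _; rewrite leq_mul2r (ltnW lt) orbT.
    + move=> _; rewrite mulSn.
      have := h5 lt; have : (ncovered K S gs + d) * Q <= ncovered K (best K S gs) gs * Q.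
        by rewrite leq_mul2r gain orbT.
      by rewrite mulnDl; lia.
have [h1 h2 [a [h3 h4 _]]] := inv gs.
(* Otherwise each of the [size gs] rounds covered a new gate, so [size gs < 3 * n], against [le] and
   [le_n]. *)
have cov : 3 * n <= ncovered K (foldl F [::] gs) gs.
  by rewrite leqNgt; apply/negP => lt; have := h2 lt; lia.
by split => //; [apply: leq_trans cov; lia | exists a].
Qed.

(** * From raw gates to circuits *)

Definition raw_gate k n (g : gate k n) : rgate :=
  ([seq val i | i <- wires g], val (table g)).
Definition raw k n m (C : circuit k n m) : seq rgate := [seq raw_gate g | g <- C].

Lemma enc_seq_map T U (f : T -> U) (e : U -> tree) (e' : T -> tree) s :
  (forall x, e (f x) = e' x) -> enc_seq e (map f s) = enc_seq e' s.
Proof. by move=> h; elim: s => //= x s ->; rewrite h. Qed.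

(** Forgetting the bounds in the types leaves the tree unchanged, so the program for [solve] runs on
    the encoded circuit as it stands. *)
Lemma enc_raw k n m (C : circuit k n m) : enc_circuit C = enc (n, raw C).
Proof.
rewrite /enc_circuit /raw; congr Cons; symmetry; apply: enc_seq_map => g.
by congr Cons; apply: enc_seq_map.
Qed.

Lemma raw_eval_gate k n (g : gate k n) (x : n.-tuple bool) :
  raw_eval (raw_gate g) x = gate_eval g x.
Proof.
rewrite /raw_eval /gate_eval /raw_gate /= -map_comp; congr (nth _ _ (bits_val _)).
by apply: eq_map => i /=; rewrite (tnth_nth false).
Qed.

Lemma wf_raw K k n m (C : circuit k n m) : k <= K + 2 -> all (wf_gate K n) (raw C).
Proof.
move=> le; rewrite /raw; elim: (tval C) => //= g s ->.
rewrite andbT /wf_gate /= size_map size_tuple; apply/andP; split.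
  by apply: leq_trans le; rewrite -ltnS ltn_ord.
by apply/allP => _ /mapP[i _ ->]; apply: ltn_ord.
Qed.

Lemma sz_raw k n m (C : circuit k n m) : 0 < m ->
  sz (n, raw C) <= (4 * 2 ^ k + 4 * k + 9) * (n + m) ^ 2.
Proof.
move=> m0; rewrite sz_pair sz_nat /raw.
have sz_g g : sz (@raw_gate k n g) <= (k * (2 * n + 2)).+1 + (4 * 2 ^ k).+1 + 1.
  rewrite /raw_gate sz_pair -addn1 leq_add2r; apply: leq_add; last first.
    apply: leq_trans (sz_bits _) _; rewrite ltnS size_tuple leq_mul2l /=.
    by rewrite leq_exp2l // -ltnS ltn_ord.
  apply: leq_trans (sz_map_le (M := 2 * n + 1) _) _.
    by move=> s1 i s2 _; rewrite sz_nat -mul2n addn1 ltnS leq_mul2l /= ltnW.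
  rewrite ltnS size_tuple leq_mul //; [by rewrite -ltnS ltn_ord | lia].
have := sz_map_le (f := @raw_gate k n) (s := val C) (fun _ g _ _ => sz_g g).
rewrite size_tuple expnS expn1; set z := sz _; set N := (n + m) * (n + m).
have nN : n <= N by rewrite /N mulnDl; nia.
have mN : m <= N by rewrite /N; nia.
have mnN : m * n <= N by rewrite /N; nia.
have := leq_mul (leqnn k) mN; have := leq_mul (leqnn k) mnN.
have := leq_mul (leqnn (2 ^ k)) mN; move: (2 ^ k) => P; lia.
Qed.

Theorem theorem4p5 (k : nat) (hk : 3 <= k) :
  exists (P : cmd) (c : nat),
    forall (n m : nat) (C : circuit k n m),
      0 < m -> 3 * n ^ (k - 2) <= m ->
      exists (y : m.-tuple bool) (t : nat),
        [/\ halts_with P (enc_circuit C) (enc_bits y) t,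
            y \notin codom (circuit_eval C)
          & t <= time_bound c k n m].
Proof.
pose K := k - 2; have kE : k = K + 2 by rewrite subnK // ltnW.
have K0 : 0 < K by rewrite subn_gt0.
have [p [T [hp [c hc] _]]] := pt_solve K.
(* [c0] gives |S| <= K + c0 n^(k-1) / m, with 18 = 3 * 6 from [greedy_spec]; [c1] is the constant of
   [sz_raw]; [c2] collects the factor [2 ^ K], [c1] and the 2 in [pb]. The summands of [d] serve the
   leading factor, the exponent of 2 and the power of [n + m]. *)
pose c0 := K * 18 * 2 ^ K; pose c1 := 4 * 2 ^ k + 4 * k + 9.
pose c2 := 2 ^ K + c1 + 2; pose d := c2 ^ c + c * c0 + 2 * c.
exists p, d => n m C m0 le.
have size_raw : size (raw C) = m by rewrite size_map size_tuple.
have hg : all (wf_gate K n) (raw C) by apply: wf_raw; rewrite -kE.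
have [lt_S cov cov0 [a [size_S le_a]]] :
    [/\ all (fun v => v < n) (greedy K n (raw C)),
      3 * n <= ncovered K (greedy K n (raw C)) (raw C),
      0 < ncovered K (greedy K n (raw C)) (raw C)
    & exists a, size (greedy K n (raw C)) <= K * a /\
        a.-1 * size (raw C) <= 3 * n * (6 * 2 ^ K * n ^ K)].
  by apply: greedy_spec; rewrite ?size_raw.
rewrite size_raw in le_a.
have size_y : size (solve K n (raw C)) == m.
  by rewrite size_rev; have [-> _ _] := run_bounds K n (greedy K n (raw C)) (raw C);
    rewrite size_raw.
have [s [t [ex out _ le_t]]] :=
  hp (n, raw C) (update (fun=> Nil) 0 (enc_circuit C)) (enc_raw C).
exists (Tuple size_y), t; split.
- by exists s; rewrite ?out.
- apply/negP => /codomP[x]; move/(congr1 val) => /= e.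
  apply: (run_avoids (x := val x) hg lt_S cov cov0).
  move: e; rewrite /solve => ->; rewrite /raw -map_comp.
  rewrite (eq_map (g := fun g => gate_eval g x)); last first.
    by move=> g; apply: raw_eval_gate.
  by rewrite -[X in _ = [seq _ | _ <- X]](map_tnth_enum C) -map_comp.
- apply: leq_trans le_t _; apply: leq_trans (hc _) _; rewrite /base.
  set E := 2 ^ ((c0 * n ^ (k - 1)) %/ m).
  have le_E : 2 ^ size (greedy K n (raw C)) <= 2 ^ K * E.
    rewrite -expnD leq_exp2l //; apply: leq_trans size_S _.
    (* The round missing from the estimate is paid for by the factor [2 ^ K]. *)
    have : K * a <= K + K * a.-1 by case: (a) => [|b]; rewrite ?muln0 //= mulnS.
    move/leq_trans; apply; rewrite leq_add2l leq_divRL // -mulnA.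
    apply: leq_trans (leq_mul (leqnn K) le_a) _.
    rewrite (_ : k - 1 = K.+1) /c0 ?expnS; lia.
  have E0 : 0 < E by rewrite expn_gt0.
  have nm0 : 0 < n + m by rewrite addn_gt0 m0 orbT.
  have le_base : (2 ^ size (greedy K n (raw C)) + sz (n, raw C)).+2 <=
      c2 * E * (n + m) ^ 2.
    have := sz_raw C m0; rewrite -/c1 /c2.
    have F0 : 0 < (n + m) ^ 2 by rewrite expn_gt0 nm0.
    move: le_E; set x := 2 ^ size _; set z := sz _; move: F0 E0.
    move: (E) ((n + m) ^ 2) (2 ^ K) => e F P F0 e0 h1 h2.
    have h3 := leq_mul (leqnn (P * e)) F0; have h4 := leq_mul e0 (leqnn (c1 * F)).
    have h5 := leq_mul e0 F0; lia.
  apply: leq_trans (leq_exp2r' c le_base) _.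
  rewrite 2!expnMn /time_bound -(expnM (n + m)).
  apply: leq_mul; last by rewrite leq_pexp2l // /d; lia.
  apply: leq_mul; first by rewrite /d; lia.
  (* Multiplying the integer quotient by [c] gives at most the quotient of the multiplied numerator,
     so the [c]-th power of [E] fits the bound. *)
  rewrite /E -expnM leq_exp2l // leq_divRL //.
  apply: (leq_trans (n := c * (c0 * n ^ (k - 1)))); last first.
    by rewrite mulnA leq_mul2r /d; apply/orP; right; lia.
  by rewrite mulnAC mulnC leq_mul2l leq_trunc_div orbT.
Qed.
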